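(* Let $E$ be a standard Borel space, $X=E^{\mathbb N}$, and let $p$ be a fixed Borel probability measure on $E$. (Equilibrium states.) Let $f\in C_b(X,\mathbb R)$ be a bounded and continuous potential. Then there exists a shift-invariant finitely additive probability measure $\mu_f\in\mathscr M^a_\sigma(X)$ which attains the supremum $$\sup_{\mu\in\mathscr M^a_\sigma(X)}\ \mathrm h^{\mathrm v}(\mu)+\langle\mu,f\rangle .$$ (Ergodic optimization.) Let $E$ be a non-compact space. Then there exists a bounded and continuous potential $f\in C_b(X,\mathbb R)$ having a unique maximizing measure, i.e. there is exactly one $\mu\in\mathscr M^a_\sigma(X)$ (finitely but not necessarily countably additive) such that $$\langle \mu,f\rangle=m(f):=\sup_{\nu\in\mathscr M^a_\sigma(X)}\langle\nu,f\rangle .$$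
   Context: A standard Borel space is given by a complete separable metric space $(E,d_E)$ with its Borel sigma-algebra. $X=E^{\mathbb N}$ carries the metric $d_X(x,y)=\sum_{n\ge1}2^{-n}\min\{d_E(x_n,y_n),1\}$, and $\sigma:X\to X$, $(x_1,x_2,\dots)\mapsto(x_2,x_3,\dots)$ is the left shift. $C_b(X,\mathbb R)$ is the Banach space of bounded continuous real functions with the supremum norm. $rba(X)$ is the Banach space (total variation norm) of bounded, regular, finitely additive signed measures on the Borel sigma-algebra of $X$; regular means that for each Borel set $A$ and $\varepsilon>0$ there are a closed $F\subset A$ and an open $O\supset A$ with $|\mu(C)|<\varepsilon$ for all Borel $C\subset O\setminus F$. It is isometrically isomorphic to $C_b(X,\mathbb R)^*$ via integration; write $\mu(f)=\int_X f\,d\mu=\langle\mu,f\rangle$. Put $\mathscr M_1^a(X)=\{\mu\in rba(X):\mu(1)=1,\ \mu(f)\ge0\ \forall f\in C_b(X,\mathbb R), f\ge 0\}$ and $\mathscr M^a_\sigma(X)=\{\mu\in\mathscr M_1^a(X):\mu(f\circ\sigma)=\mu(f)\ \forall f\in C_b(X,\mathbb R)\}$. Fix $0<\alpha<1$. $\mathrm{Hol}(\alpha)=\{f\in C_b(X,\mathbb R): \mathrm D_\alpha(f)<\infty\}$ with $\mathrm D_\alpha(f)=\sup_{x\ne y}|f(x)-f(y)|/d_X(x,y)^\alpha$. For $f\in C_b(X,\mathbb R)$ the Ruelle operator on $C_b(X,\mathbb R)$ is $\mathscr L_f\varphi(x)=\int_E e^{f(ax)}\varphi(ax)\,dp(a)$,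 where $ax=(a,x_1,x_2,\dots)$, and $\mathscr L_f^*$ is its dual on $rba(X)$. For $g\in\mathrm{Hol}(\alpha)$ there is a unique countably additive Borel probability measure $\nu_g$ with $\mathscr L_g^*\nu_g=\lambda_g\nu_g$ for some $\lambda_g>0$; $\lambda_g$ denotes this eigenvalue (it is also the spectral radius of $\mathscr L_g$ on $\mathrm{Hol}(\alpha)$). The entropy of $\mu\in rba(X)$ is $\mathrm h^{\mathrm v}(\mu)=\inf_{g\in\mathrm{Hol}(\alpha)}\big(-\langle\mu,g\rangle+\log\lambda_g\big)\in[-\infty,\infty)$. *)

(* Defs.v *)
From HB Require Import structures.
From mathcomp Require Import all_boot all_order all_algebra.
From mathcomp Require Import all_classical all_reals all_analysis.
From mathcomp Require Import lra.

Set Implicit Arguments.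
Unset Strict Implicit.
Unset Printing Implicit Defensive.

Import Order.TTheory GRing.Theory Num.Theory.
Import numFieldNormedType.Exports.
Import HBSimple.

Local Open Scope classical_set_scope.
Local Open Scope ring_scope.

(* Complete metric spaces.  The base point comes with the library's complete
   and measurable types; it costs no generality for a space that carries a
   probability measure. *)
#[short(type="completeMetricType")]
HB.structure Definition CompleteMetric (R : numDomainType) :=
  { T of Complete T & Metric R T }.

Definition separable (T : topologicalType) : Prop :=
  exists D : set T, countable D /\ dense D.

Notation borel T := (g_sigma_algebraType (@open T)).

Section seq_space_metric.
Context {R : realType} (E : metricType R).

(* A sequence is indexed from 0 here: the coordinate x_(n+1) is x n. *)
Definition seq_space : Type := nat -> E.

Implicit Types x y z : seq_space.

Definition seq_dist_term x y : R^nat :=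
  fun n => 2^-1 ^+ n.+1 * Num.min (mdist (x n) (y n)) 1.

Definition seq_dist x y : R := limn (series (seq_dist_term x y)).

Let term_ge0 x y n : 0 <= seq_dist_term x y n.
Proof. by rewrite mulr_ge0 ?exprn_ge0 ?invr_ge0// le_min mdist_ge0 ler01. Qed.

Let cvg_term x y : cvgn (series (seq_dist_term x y)).
Proof.
apply: (@series_le_cvg _ _ (geometric 2^-1 2^-1)) => [n|n|n|].
- exact: term_ge0.
- by rewrite /geometric/= mulr_ge0 ?exprn_ge0 ?invr_ge0.
- by rewrite /geometric/= -exprS ler_piMr ?exprn_ge0 ?invr_ge0// ge_min lexx orbT.
- by apply: is_cvg_geometric_series; rewrite ger0_norm ?invr_ge0// invf_lt1// ltr1n.
Qed.

Let seq_distxx x : seq_dist x x = 0.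
Proof.
rewrite /seq_dist (_ : series _ = cst 0) ?lim_cst//.
apply/funext => n; rewrite /series/= big1// => i _.
by rewrite /seq_dist_term mdistxx min_l ?ler01// mulr0.
Qed.

Let seq_dist_ge_term x y n : seq_dist_term x y n <= seq_dist x y.
Proof.
apply: (@le_trans _ _ (series (seq_dist_term x y) n.+1)).
  by rewrite /series/= big_nat_recr//= lerDr sumr_ge0.
apply: nondecreasing_cvgn_le; last exact: cvg_term.
by apply: nondecreasing_series => i _ _; exact: term_ge0.
Qed.

Let seq_dist_positivity x y : seq_dist x y = 0 -> x = y.
Proof.
move=> xy0; apply/funext => n; apply: (@mdist_positivity R).
have := seq_dist_ge_term x y n.
rewrite xy0 /seq_dist_term pmulr_rle0 ?exprn_gt0 ?invr_gt0//.
rewrite ge_min ler10 orbF => d0.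
by apply/eqP; rewrite eq_le d0 mdist_ge0.
Qed.

Let seq_dist_sym x y : seq_dist x y = seq_dist y x.
Proof.
rewrite /seq_dist (_ : seq_dist_term x y = seq_dist_term y x)//.
by apply/funext => n; rewrite /seq_dist_term metric_sym.
Qed.

Let seq_dist_triangle y x z : seq_dist x z <= seq_dist x y + seq_dist y z.
Proof.
rewrite /seq_dist -limD//; [|exact: cvg_term..].
apply: ler_lim; first exact: cvg_term.
  by apply: is_cvgD; exact: cvg_term.
apply: nearW => n; rewrite fctE /series/= -big_split/=; apply: ler_sum => i _.
rewrite /seq_dist_term -mulrDr ler_wpM2l ?exprn_ge0 ?invr_ge0//.
have := metric_triangle (x i) (y i) (z i).
have := mdist_ge0 (x i) (y i); have := mdist_ge0 (y i) (z i).
rewrite /Num.min; do 3 case: ifPn => //; rewrite -?leNgt; lra.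
Qed.

HB.instance Definition _ := gen_eqMixin seq_space.
HB.instance Definition _ := gen_choiceMixin seq_space.
HB.instance Definition _ := isMetric.Build R seq_space
  seq_distxx seq_dist_positivity seq_dist_sym seq_dist_triangle.

Definition shift x : seq_space := fun n => x n.+1.

Definition scons (a : E) x : seq_space := fun n => if n is m.+1 then x m else a.

End seq_space_metric.

HB.instance Definition _ (R : realType) (E : completeMetricType R) :=
  isPointed.Build (seq_space E) (fun=> point).

Section thermodynamic_formalism.
Context {R : realType} {E : completeMetricType R}.

Local Notation X := (seq_space E).
Local Notation charges := ({additive_charge set (borel X) -> \bar R}%R).
Implicit Types (f g phi : X -> R) (mu nu : charges).

Definition Cb : set (X -> R) := [set f | continuous f /\ bounded_fun f].

Definition holder_seminorm (alpha : R) f : \bar R :=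
  ereal_sup [set (`|f xy.1 - f xy.2| / mdist xy.1 xy.2 `^ alpha)%:E
            | xy in [set xy : X * X | xy.1 <> xy.2]].

Definition Hol (alpha : R) : set (X -> R) :=
  [set f | Cb f /\ (holder_seminorm alpha f < +oo)%E].

(* An additive charge is real-valued and finitely additive on the Borel sets;
   its values on other sets carry no information. *)
Definition rba : set charges :=
  [set mu : charges |
    (exists M : R, forall A : set (borel X), measurable A -> (`|mu A| <= M%:E)%E) /\
    (forall A : set (borel X), measurable A -> forall e : R, 0 < e ->
      exists F O : set X, [/\ closed F, F `<=` A, open O, A `<=` O &
        forall C : set (borel X), measurable C -> C `<=` O `\` F ->
          (`|mu C| < e%:E)%E])].

(* Integral of a bounded Borel function against a bounded finitely additive
   set function, as a limit of integrals of uniformly converging simple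
   functions.  The library's integral cannot be used: it needs countable
   additivity. *)
Definition is_fa_integral (mu : set (borel X) -> \bar R) f (I : R) : Prop :=
  exists s : {sfun borel X >-> R}^nat,
    (forall e : R, 0 < e -> \forall n \near \oo, forall x, `|s n x - f x| < e) /\
    (fine (sintegral mu (s n)) @[n --> \oo] --> I).

Definition pairing (mu : set (borel X) -> \bar R) f : R :=
  xget 0 (is_fa_integral mu f).

Definition M1a : set charges :=
  [set mu : charges | [/\ rba mu, pairing mu (cst 1) = 1 &
    forall f, Cb f -> (forall x, 0 <= f x) -> 0 <= pairing mu f]].

Definition Msigma : set charges :=
  [set mu : charges | M1a mu /\
    forall f, Cb f -> pairing mu (f \o @shift R E) = pairing mu f].

Definition max_mean f : \bar R :=
  ereal_sup [set (pairing nu f)%:E | nu in Msigma].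

Variable p : probability (borel E) R.

Definition ruelle f phi : X -> R :=
  fun x => \int[p]_a (expR (f (scons a x)) * phi (scons a x)).

(* [l] is a positive eigenvalue of the dual of [ruelle g] with a countably
   additive eigenprobability.  Elements of rba are equal as soon as they agree
   as functionals on Cb, so this is the equation for the dual operator. *)
Definition dual_eigenvalue g (l : R) : Prop :=
  0 < l /\ exists nu : probability (borel X) R,
    forall phi, Cb phi -> pairing nu (ruelle g phi) = l * pairing nu phi.

Definition lambda g : R := xget 0 (dual_eigenvalue g).

Definition entropy (alpha : R) mu : \bar R :=
  ereal_inf [set (- pairing mu g + ln (lambda g))%:E | g in Hol alpha].

End thermodynamic_formalism.

(* Main.v *)
Require Import Defs.
From HB Require Import structures.
From mathcomp Require Import all_boot all_order all_algebra finmap.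
From mathcomp Require Import all_classical all_reals all_analysis measurable_realfun.
From mathcomp Require Import lra.

Set Implicit Arguments.
Unset Strict Implicit.
Unset Printing Implicit Defensive.

Import Order.TTheory GRing.Theory Num.Theory.
Import numFieldNormedType.Exports.
Import HBSimple.

Local Open Scope classical_set_scope.
Local Open Scope ring_scope.

(** Both maximizers are found among regular charges, and in both cases the work is
    to pass from a positive functional on the bounded continuous functions to a
    charge.

    Equilibrium states.  The entropy is an infimum of affine functionals that are
    continuous for pointwise convergence on [Cb], so a limit of a maximizing
    sequence is a natural candidate for a maximizer.  Such a limit [L], taken along
    an ultrafilter, is a shift-invariant mean on [Cb], and one has to show that a
    charge regular on all Borel sets represents it.  The entropy provides the
    necessary tightness.  For a potential [g x = t * u (x 0)] the operator dual to
    [ruelle g] has no other possible eigenvalue than the integral of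
    [expR (t * u)] (lemma [ln_lambda_le]).  If [u] is close to the indicator of the
    complement of a finite union of small balls, this integral stays bounded for
    large [t], and a lower bound on the entropy of [mu] forces the integral of
    [u (x 0)] against [mu] to be small (lemma [entropy_tight]).  Since [E] is
    complete, a shift-invariant mean that is tight in this sense is continuous
    along decreasing sequences of functions (lemma [tight_sigma_smooth]), and the
    Riesz construction of an outer measure from the values on open sets represents
    it by a regular charge (lemmas [riesz_rba] and [riesz_pairing]).  If the
    supremum is minus infinity, every invariant charge attains it, for instance the
    Dirac measure at a constant sequence.

    Ergodic optimization.  The negated distance to a constant sequence has the
    maximum [0], attained by the Dirac measure at this sequence.  Any other
    maximizing charge induces the same functional on [Cb], and regularity makes a
    charge determined by its functional (lemma [rba_unique]). *)

(** * Integration against finitely additive set functions *)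

Lemma le_scale0 (R : realFieldType) (c x : R) : 0 <= c -> (forall e, 0 < e -> x <= c * e) -> x <= 0.
Proof.
move=> c0 xc; apply/ler_addgt0Pr => e e0; rewrite add0r.
have d0 : 0 < e / (c + 1) by rewrite divr_gt0//; lra.
apply: (le_trans (xc _ d0)); by rewrite mulrA ler_pdivrMr; lra.
Qed.

Section simple_integral.
Context d (T : measurableType d) (R : realType).
Implicit Types (mu : set T -> \bar R) (f g : T -> R) (A B D : set T) (M : R).

Definition bounded_additive mu M : Prop :=
  measure_function.semi_additive mu /\
  forall A, measurable A -> (`|mu A| <= M%:E)%E.

Definition simple f : Prop := measurable_fun setT f /\ finite_set (range f).

Definition sint mu f : R := fine (sintegral mu f).

Lemma bounded_additive0 mu M : bounded_additive mu M -> mu set0 = 0%E.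
Proof.
move=> [/(_ (fun=> set0) 0%N) + _]; rewrite !big_ord0; apply => //.
exact: trivIset_set0.
Qed.

Lemma bounded_additive_fin mu M A : bounded_additive mu M -> measurable A ->
  mu A \is a fin_num.
Proof.
move=> [_ bmu] mA; rewrite fin_num_abs.
by rewrite (le_lt_trans (bmu _ mA))// ltry.
Qed.

Lemma bounded_additiveU mu M A B : bounded_additive mu M ->
  measurable A -> measurable B -> A `&` B = set0 ->
  fine (mu (A `|` B)) = fine (mu A) + fine (mu B).
Proof.
move=> bmu mA mB AB; rewrite (semi_additiveW (bounded_additive0 bmu) bmu.1)//.
  by rewrite fineD// (bounded_additive_fin bmu).
exact: measurableU.
Qed.

Lemma measurable_fibers (J : finType) (h : T -> J) (P : pred J) :
  (forall j, measurable (h @^-1` [set j])) -> measurable (h @^-1` [set j | P j]).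
Proof.
move=> mh; rewrite (_ : _ @^-1` _ = \bigcup_(j in [set j | P j]) h @^-1` [set j]).
  apply: fin_bigcup_measurable => [|j _]; [exact: finite_finset|exact: mh].
apply/seteqP; split => [x Px|x [j Pj hx]]; first by exists (h x).
by rewrite /= hx.
Qed.

Lemma bounded_additive_fibers mu M (J : finType) (h : T -> J) (P : pred J) :
  bounded_additive mu M -> (forall j, measurable (h @^-1` [set j])) ->
  fine (mu (h @^-1` [set j | P j])) = \sum_(j | P j) fine (mu (h @^-1` [set j])).
Proof.
move=> bmu mh; rewrite -big_filter.
have -> : h @^-1` [set j | P j] =
    h @^-1` [set j | j \in [seq j <- index_enum J | P j]].
  apply/seteqP; split => x /=; rewrite mem_filter ?mem_index_enum ?andbT//.
set s := [seq j <- _ | _]; have us : uniq s by rewrite filter_uniq// index_enum_uniq.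
elim: s us => [_|j s ih /= /andP[js us]].
  rewrite big_nil (_ : _ @^-1` _ = set0)// ?(bounded_additive0 bmu)//.
  by rewrite -subset0 => x /=; rewrite in_nil.
have IH := ih us.
have ms : measurable (h @^-1` [set i | i \in s]).
  exact: (measurable_fibers (mem s)).
have -> : h @^-1` [set i | i \in j :: s] =
    h @^-1` [set j] `|` h @^-1` [set i | i \in s].
  apply/seteqP; split => x /=; rewrite inE.
    by move=> /orP[/eqP|]; [left|right].
  by move=> [->|->]; rewrite ?eqxx ?orbT.
rewrite (bounded_additiveU bmu)// ?big_cons ?IH//.
by rewrite -subset0 => x /= [->]; rewrite (negbTE js).
Qed.

(** Every factorisation of a simple function through a finite type computes its
    integral.  Two simple functions factor through a common finite type, which
    turns statements about their integrals into statements about finite sums. *)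
Lemma sint_factor mu M (J : finType) (h : T -> J) (c : J -> R) :
  bounded_additive mu M -> (forall j, measurable (h @^-1` [set j])) ->
  sint mu (c \o h) = \sum_j c j * fine (mu (h @^-1` [set j])).
Proof.
move=> bmu mh; rewrite /sint /sintegral.
have mc x : measurable ((c \o h) @^-1` [set x]) /\
    fine (mu ((c \o h) @^-1` [set x])) =
    \sum_(j | c j == x) fine (mu (h @^-1` [set j])).
  rewrite (_ : _ @^-1` _ = h @^-1` [set j | c j == x]).
    by split; [exact: measurable_fibers|exact: bounded_additive_fibers bmu mh].
  by apply/seteqP; split => t /= /eqP.
have fc : finite_set (range c).
  by apply: finite_image; exact: finite_finset.
rewrite -(fsbig_widen (range c))//; last first.
  move=> x [_ /= ncx]; rewrite (_ : _ @^-1` _ = set0).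
    by rewrite (bounded_additive0 bmu) mule0.
  by rewrite -subset0 => t /= htx; apply: ncx; exists (h t).
rewrite (eq_fsbigr (fun x => (x * fine (mu ((c \o h) @^-1` [set x])))%:E)); last first.
  move=> x _; rewrite EFinM fineK//.
  exact: (bounded_additive_fin bmu (mc x).1).
rewrite fsumEFin// fsbig_finite//=.
under eq_bigr => x _ do rewrite (mc x).2 mulr_sumr big_mkcond.
rewrite exchange_big/=; apply: eq_bigr => j _.
rewrite -big_mkcond/= (eq_bigl (fun x => x == c j)); last by move=> x; rewrite eq_sym.
rewrite -big_filter filter_pred1_uniq ?big_seq1//; first exact: fset_uniq.
by rewrite in_fset_set// inE; exists j.
Qed.

Lemma simple_factor f : simple f -> exists (J : finType) (h : T -> J) (c : J -> R),
  (forall j, measurable (h @^-1` [set j])) /\ f = c \o h.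
Proof.
move=> [mf ff]; set s := fset_set (range f).
have fs x : f x \in s by rewrite in_fset_set// inE; exists x.
exists s, (fun x => [` fs x]%fset), val; split=> // j.
rewrite (_ : _ @^-1` _ = f @^-1` [set val j]).
  by rewrite -[X in measurable X]setTI; exact: mf.
apply/seteqP; split => x /=; first by move=> <-.
by move=> fxj; apply/val_inj.
Qed.

Lemma simple_factor2 f g : simple f -> simple g ->
  exists (J : finType) (h : T -> J) (a b : J -> R),
  [/\ (forall j, measurable (h @^-1` [set j])), f = a \o h & g = b \o h].
Proof.
move=> /simple_factor[J [h [a [mh ->]]]] /simple_factor[K [k [b [mk ->]]]].
exists (J * K)%type, (fun x => (h x, k x)), (a \o fst), (b \o snd); split=> //.
move=> [i j]; rewrite (_ : _ @^-1` _ = h @^-1` [set i] `&` k @^-1` [set j]).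
  exact: measurableI.
by apply/seteqP; split => x /= [-> ->].
Qed.

Lemma factor_simple (J : finType) (h : T -> J) (c : J -> R) :
  (forall j, measurable (h @^-1` [set j])) -> simple (c \o h).
Proof.
move=> mh; split; last first.
  rewrite (_ : range _ = c @` range h); last by rewrite image_comp.
  exact/finite_image/(@finite_finset J).
move=> _ A mA; rewrite setTI comp_preimage.
have -> : c @^-1` A = [set j | c j \in A] by apply/seteqP; split => j /=; rewrite inE.
exact: measurable_fibers.
Qed.

Lemma simple_lin a f g : simple f -> simple g -> simple (fun x => a * f x + g x).
Proof.
move=> sf sg; have [J [h [b [c [mh -> ->]]]]] := simple_factor2 sf sg.
exact: (factor_simple (fun j => a * b j + c j)).
Qed.

Lemma simple_mul f g : simple f -> simple g -> simple (fun x => f x * g x).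
Proof.
move=> sf sg; have [J [h [b [c [mh -> ->]]]]] := simple_factor2 sf sg.
exact: (factor_simple (fun j => b j * c j)).
Qed.

Lemma simple_indic A : measurable A -> simple \1_A.
Proof.
move=> mA; split; first exact: measurable_indic.
apply: (@sub_finite_set _ _ [set 0; 1]); last exact: finite_set2.
by move=> _ [x _ <-]; rewrite indicE; case: (_ \in _); [right|left].
Qed.

Lemma sint_lin mu M a f g : bounded_additive mu M -> simple f -> simple g ->
  sint mu (fun x => a * f x + g x) = a * sint mu f + sint mu g.
Proof.
move=> bmu sf sg; have [J [h [b [c [mh -> ->]]]]] := simple_factor2 sf sg.
rewrite (sint_factor (fun j => a * b j + c j) bmu)// !(sint_factor _ bmu)//.
rewrite mulr_sumr -big_split/=; apply: eq_bigr => j _.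
by rewrite mulrDl mulrA.
Qed.

Lemma sint_ge0 mu M f : bounded_additive mu M -> simple f ->
  (forall A, measurable A -> (0 <= mu A)%E) -> (forall x, 0 <= f x) ->
  0 <= sint mu f.
Proof.
move=> bmu sf mu0; have [J [h [c [mh ->]]]] := simple_factor sf => f0.
rewrite (sint_factor _ bmu)//; apply: sumr_ge0 => j _.
have [->|/set0P[x /= hx]] := eqVneq (h @^-1` [set j]) set0.
  by rewrite (bounded_additive0 bmu) mulr0.
by rewrite mulr_ge0 ?fine_ge0 ?mu0// -hx f0.
Qed.

Lemma sint_indic mu M A : bounded_additive mu M -> measurable A ->
  sint mu \1_A = fine (mu A).
Proof.
move=> bmu mA; pose h x := x \in A.
have hE b : h @^-1` [set b] = if b then A else ~` A.
  apply/seteqP; split => x /=; rewrite /h.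
    by move=> <-; case: ifPn; rewrite ?inE// notin_setE.
  by case: b => ?; [exact: mem_set|exact: memNset].
rewrite (_ : \1_A = (fun b : bool => b%:R) \o h); last by apply/funext => x; rewrite indicE.
rewrite (sint_factor _ bmu); last by case; rewrite hE//; exact: measurableC.
by rewrite big_bool/= !hE mul0r addr0 mul1r.
Qed.

(** The factor 2 pays for the signs: the total mass of the fibres splits into
    one set of nonnegative and one of negative mass. *)
Lemma sint_le mu M D e K f : bounded_additive mu M -> measurable D -> 0 <= K ->
  (forall C, measurable C -> C `<=` D -> (`|mu C| <= e%:E)%E) ->
  simple f -> (forall x, D x -> `|f x| <= K) -> (forall x, ~ D x -> f x = 0) ->
  `|sint mu f| <= 2 * e * K.
Proof.
move=> bmu mD K0 De sf; have [J [h [c [mh ->]]]] := simple_factor sf => fK f0.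
rewrite (sint_factor _ bmu)//; set nu := fun j => fine (mu (h @^-1` [set j])).
have mP (P : pred J) : `|\sum_(j | (c j != 0) && P j) nu j| <= e.
  rewrite -(bounded_additive_fibers _ bmu)//.
  have mm : measurable (h @^-1` [set j | (c j != 0) && P j]).
    exact: measurable_fibers.
  rewrite -lee_fin -fine_abse ?fineK ?(bounded_additive_fin bmu)//; last first.
    by rewrite fin_num_abs abse_id (le_lt_trans (bmu.2 _ mm))// ltry.
  apply: De => // x /= /andP[c0 _]; apply: contrapT => /f0 /= cx0.
  by rewrite cx0 eqxx in c0.
have cK j : c j != 0 -> nu j != 0 -> `|c j| <= K.
  move=> c0; have [E|/set0P[x /= hx] _] := eqVneq (h @^-1` [set j]) set0.
    by rewrite /nu E (bounded_additive0 bmu) eqxx.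
  rewrite -hx; apply: fK; apply: contrapT => /f0 /= cx0.
  by rewrite -hx cx0 eqxx in c0.
have jE (P : pred J) : \sum_(j | (c j != 0) && P j) nu j =
    \sum_(j | c j != 0) (if P j then nu j else 0).
  by rewrite -big_mkcondr.
have le_abs : \sum_(j | c j != 0) `|nu j| <= 2 * e.
  rewrite (eq_bigr (fun j => (if 0 <= nu j then nu j else 0) -
      (if ~~ (0 <= nu j) then nu j else 0))); last first.
    by move=> j _; case: ger0P => nuj /=; lra.
  rewrite big_split/= sumrN -!jE.
  have := mP (fun j => 0 <= nu j); have := mP (fun j => ~~ (0 <= nu j)).
  by rewrite !ler_norml => /andP[? ?] /andP[? ?]; lra.
rewrite (bigID (fun j => c j == 0))/= big1 ?add0r; last first.
  by move=> j /eqP ->; rewrite mul0r.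
apply: (le_trans (ler_norm_sum _ _ _)).
apply: (@le_trans _ _ (K * \sum_(j | c j != 0) `|nu j|)).
  rewrite mulr_sumr; apply: ler_sum => j cj; rewrite normrM -/(nu j).
  have [->|nuj] := eqVneq (nu j) 0; first by rewrite normr0 !mulr0.
  by rewrite ler_wpM2r// cK.
by rewrite mulrC ler_wpM2r.
Qed.

End simple_integral.

(** Rounding down to multiples of [1 / n.+1] approximates a bounded measurable
    function uniformly by simple functions. *)
Section quantization.
Context {R : realType}.

Definition quantize (n : nat) (y : R) : R :=
  (Num.floor (y * n.+1%:R))%:~R / n.+1%:R.

Lemma quantize_close n y : `|quantize n y - y| <= n.+1%:R^-1.
Proof.
have /andP[fl fu] := floor_itv (y * n.+1%:R).
have -> : quantize n y - y =
    ((Num.floor (y * n.+1%:R))%:~R - y * n.+1%:R) / n.+1%:R.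
  by rewrite mulrBl mulfK// pnatr_eq0.
rewrite normrM (ger0_norm (_ : 0 <= n.+1%:R^-1)) ?invr_ge0//.
rewrite ler_piMl ?invr_ge0// ler_norml; rewrite intrD in fu.
by lra.
Qed.

Lemma measurable_quantize n : measurable_fun setT (quantize n).
Proof.
apply: nondecreasing_measurable => // x y xy.
rewrite ler_wpM2r ?invr_ge0// ler_int; apply: le_floor.
by rewrite ler_wpM2r.
Qed.

Lemma finite_quantize n (A : set R) K : (forall y, A y -> `|y| <= K) ->
  finite_set (quantize n @` A).
Proof.
move=> AK; pose m := `|Num.ceil (K * n.+1%:R)|%N.+1.
apply: (@sub_finite_set _ _
    ((fun z : int => z%:~R / n.+1%:R) @` (Posz @` `I_m `|` Negz @` `I_m))); last first.
  by apply: finite_image; rewrite finite_setU; split;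
    apply: finite_image; exact: finite_II.
move=> _ [y Ay <-]; exists (Num.floor (y * n.+1%:R)) => //.
have := AK _ Ay; rewrite ler_norml => /andP[Ky yK].
have K0 : 0 <= K by apply: le_trans (AK _ Ay).
(* the successor in [m] leaves room for a floor that reaches its bound *)
have mE : (m%:Z = Num.ceil (K * n.+1%:R) + 1)%R.
  rewrite /m -addn1 PoszD gez0_abs// -(ler_int R).
  by rewrite (le_trans _ (ceil_ge _))// mulr_ge0.
have Km : K * n.+1%:R <= m%:Z%:~R - 1 by rewrite mE intrD addrK ceil_ge.
have lo : - m%:Z <= Num.floor (y * n.+1%:R).
  rewrite floor_ge_int intrN; apply: (@le_trans _ _ (- K * n.+1%:R)).
    by rewrite mulNr lerN2; lra.
  by rewrite ler_wpM2r.
have hi : Num.floor (y * n.+1%:R) < m%:Z.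
  rewrite -(ltr_int R) (le_lt_trans (ge_floor _))//.
  by rewrite (@le_lt_trans _ _ (K * n.+1%:R)) ?ler_wpM2r//; lra.
case: (Num.floor _) lo hi => k /=.
  by rewrite ltz_nat => _ km; left; exists k.
by rewrite NegzE lerN2 lez_nat => km _; right; exists k.
Qed.

End quantization.

Section pairing.
Context {R : realType} {E : completeMetricType R}.
Local Notation X := (seq_space E).
Implicit Types (mu : set (borel X) -> \bar R) (f g : X -> R) (M e : R).

(** The bounded Borel functions. *)
Definition Bb : set (X -> R) :=
  [set f | measurable_fun setT (f : borel X -> R) /\
    exists K : R, forall x, `|f x| <= K].

Lemma simple_sfun f : @simple _ (borel X) R f ->
  exists s : {sfun borel X >-> R}, (s : X -> R) = f.
Proof.
move=> [mf ff]; have fP : f \in @sfun _ (borel X) R.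
  by apply/andP; split; apply/mem_set.
by exists (sfun_Sub fP).
Qed.

Lemma Bb_approx f e : Bb f -> 0 < e ->
  exists s, @simple _ (borel X) R s /\ forall x, `|s x - f x| <= e.
Proof.
move=> [mf [K fK]] e0; pose n := `|Num.ceil e^-1|%N.
exists (quantize n \o f); split.
  split; first exact: (measurableT_comp (measurable_quantize n)).
  rewrite (_ : range _ = quantize n @` range f); last by rewrite image_comp.
  by apply: (@finite_quantize _ _ _ K) => _ [x _ <-].
move=> x; apply: (le_trans (quantize_close _ _)).
rewrite invf_ple ?posrE// (le_trans (ceil_ge _))//.
rewrite -natr1 /n natr_absz ger0_norm ?lerDl//.
by rewrite -(ler_int R) (le_trans _ (ceil_ge _))// invr_ge0 ltW.
Qed.

Lemma sint_close mu M f g e : bounded_additive mu M -> 0 <= e ->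
  @simple _ (borel X) R f -> @simple _ (borel X) R g ->
  (forall x, `|f x - g x| <= e) -> `|sint mu f - sint mu g| <= 2 * M * e.
Proof.
move=> bmu e0 sf sg fg; rewrite distrC.
have := sint_lin (-1) bmu sf sg; rewrite mulN1r addrC => <-.
apply: (@sint_le _ _ _ mu M setT M e) => //.
- by move=> C mC _; exact: bmu.2.
- exact: simple_lin.
- by move=> x _; rewrite mulN1r addrC distrC.
- by move=> x /(_ I).
Qed.

Lemma bounded_additive_ge0 mu M : bounded_additive mu M -> 0 <= M.
Proof.
move=> bmu; have := bmu.2 _ measurable0.
by rewrite (bounded_additive0 bmu) abse0 lee_fin.
Qed.

(** The integral is Lipschitz for the uniform norm, so its value does not depend
    on the approximating sequence; every property of [pairing] below is obtained
    by comparison with a single simple function. *)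
Lemma is_fa_integral_close mu M f s e I : bounded_additive mu M -> 0 <= e ->
  is_fa_integral mu f I -> @simple _ (borel X) R s ->
  (forall x, `|s x - f x| <= e) -> `|sint mu s - I| <= 2 * M * e.
Proof.
move=> bmu e0 [t [tf tI]] ss sf; apply/ler_addgt0Pr => eta eta0.
have M0 := bounded_additive_ge0 bmu.
pose d := eta / (2 * M + 1).
have d0 : 0 < d by rewrite divr_gt0//; lra.
move/cvgrPdist_le : tI => /(_ _ d0) tI.
have [n [tfn tIn]] : exists n, (forall x, `|t n x - f x| < d) /\
    `|I - sint mu ((t n))| <= d.
  near \oo => n; exists n; split; [near: n; exact: tf|near: n; exact: tI].
apply: (@le_trans _ _ (2 * M * (e + d) + d)).
  apply: le_trans (ler_distD (sint mu ((t n))) _ _) _.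
  apply: lerD; last by rewrite distrC.
  apply: sint_close => //; [lra|move=> x].
  apply: le_trans (ler_distD (f x) _ _) _; rewrite lerD//.
  by rewrite distrC ltW.
rewrite mulrDr -addrA lerD2l -[in leRHS](@divfK _ (2 * M + 1) _ eta) -/d; first lra.
by apply/eqP; lra.
Unshelve. all: by end_near. Qed.

Lemma pairingP mu M f : bounded_additive mu M -> Bb f ->
  is_fa_integral mu f (pairing mu f).
Proof.
move=> bmu fb; apply: xgetPex.
have M0 := bounded_additive_ge0 bmu.
have /choice[s sP] : forall n, exists s : {sfun borel X >-> R},
    forall x, `|s x - f x| <= n.+1%:R^-1.
  move=> n; have [|s [ss sf]] := @Bb_approx f n.+1%:R^-1 fb; first by rewrite invr_gt0.
  by have [t tE] := simple_sfun ss; exists t => x; rewrite tE.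
have sf e : 0 < e -> \forall n \near \oo, forall x, `|s n x - f x| <= e.
  move=> e0; near=> n => x; apply: (le_trans (sP _ _)); apply/ltW.
  by near: n; exact: (near_infty_natSinv_lt (PosNum e0)).
have : cauchy (sint mu ((s n)) @[n --> \oo]).
  apply: cauchy_exP => e e0; pose d := e / (4 * M + 1).
  have d0 : 0 < d by rewrite divr_gt0//; lra.
  have [N _ sN] := sf _ d0; exists (sint mu ((s N))).
  exists N => // n Nn; apply: (@le_lt_trans _ _ (2 * M * (d + d))).
    apply: sint_close => //; [lra|move=> x].
    apply: le_trans (ler_distD (f x) _ _) _; rewrite lerD ?sN//=.
    by rewrite distrC sN.
  rewrite -[ltRHS](@divfK _ (4 * M + 1) _ e) -/d; first lra.
  by apply/eqP; lra.
move=> /cauchy_cvg/cvg_ex[I sI]; exists I; exists s; split => // e e0.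
have := sf _ (divr_gt0 e0 (ltr0Sn _ 1)).
apply: filterS => n + x => /(_ x) /le_lt_trans; apply; lra.
Unshelve. all: by end_near. Qed.

Lemma pairing_close mu M f s e : bounded_additive mu M -> Bb f -> 0 <= e ->
  @simple _ (borel X) R s ->
  (forall x, `|s x - f x| <= e) -> `|sint mu s - pairing mu f| <= 2 * M * e.
Proof.
by move=> bmu fb e0; apply: is_fa_integral_close => //; exact: pairingP bmu fb.
Qed.

Lemma Bb_lin a f g : Bb f -> Bb g -> Bb (fun x => a * f x + g x).
Proof.
move=> [mf [K fK]] [mg [L gL]]; split.
  by apply: measurable_funD => //; exact: measurable_funM.
exists (`|a| * K + L) => x; rewrite (le_trans (ler_normD _ _))//.
by rewrite lerD// normrM ler_wpM2l.
Qed.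

Lemma simple_Bb f : @simple _ (borel X) R f -> Bb f.
Proof.
move=> sf; split; first exact: sf.1.
have [J [h [c [_ ->]]]] := simple_factor sf.
exists (\sum_j `|c j|) => x /=.
by rewrite (bigD1 (h x))//= lerDl sumr_ge0.
Qed.

Lemma Cb_Bb f : Cb f -> Bb f.
Proof.
move=> [cf [K [_ fK]]]; split; last by exists (K + 1) => x; apply: fK => //; lra.
apply: (measurability _ (RGenOpens.measurableE R)).
move=> _ [_ [a [b ->] <-]]; rewrite setTI; apply: sub_sigma_algebra.
by move/continuousP : cf; apply; exact: interval_open.
Qed.

Lemma pairing_simple mu M f : bounded_additive mu M -> @simple _ (borel X) R f ->
  pairing mu f = sint mu f.
Proof.
move=> bmu sf; apply/esym/eqP; rewrite -subr_eq0 -normr_le0 -(mulr0 (2 * M)).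
by apply: pairing_close => // [|x]; [exact: simple_Bb|rewrite subrr normr0].
Qed.

Lemma pairing_lin mu M a f g : bounded_additive mu M -> Bb f -> Bb g ->
  pairing mu (fun x => a * f x + g x) = a * pairing mu f + pairing mu g.
Proof.
move=> bmu bf bg; have M0 := bounded_additive_ge0 bmu.
apply/eqP; rewrite -subr_eq0 -normr_le0.
have a0 : 0 <= `|a| by [].
apply: (@le_scale0 _ (4 * M * (`|a| + 1))) => [|e e0].
  by rewrite !mulr_ge0//; lra.
have [s [ss sf]] := Bb_approx bf e0; have [t [st tg]] := Bb_approx bg e0.
have e1 : 0 <= (`|a| + 1) * e by rewrite mulr_ge0 ?ltW//; lra.
have H1 := pairing_close bmu bf (ltW e0) ss sf.
have H2 := pairing_close bmu bg (ltW e0) st tg.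
have H3 : `|sint mu (fun x => a * s x + t x) -
    pairing mu (fun x => a * f x + g x)| <= 2 * M * ((`|a| + 1) * e).
  apply: pairing_close => //; [exact: Bb_lin|exact: simple_lin|move=> x].
  rewrite (_ : _ - _ = a * (s x - f x) + (t x - g x)); last by lra.
  by rewrite (le_trans (ler_normD _ _))// normrM mulrDl mul1r lerD// ler_wpM2l.
rewrite (sint_lin _ bmu)// in H3.
have H4 : `|a * (sint mu s - pairing mu f)| <= `|a| * (2 * M * e).
  by rewrite normrM ler_wpM2l.
move: H2 H3 H4; rewrite !ler_norml; set p1 := `|a|.
move=> /andP[? ?] /andP[? ?] /andP[? ?]; apply/andP; split; lra.
Qed.

Lemma pairingZ mu M a f : bounded_additive mu M -> Bb f ->
  pairing mu (fun x => a * f x) = a * pairing mu f.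
Proof.
move=> bmu bf; have b0 : Bb (fun=> 0).
  by split; [exact: measurable_cst|exists 0 => x; rewrite normr0].
have p0 : pairing mu (fun=> 0) = 0.
  have := pairing_lin 1 bmu b0 b0.
  by rewrite (_ : (fun x => 1 * 0 + 0) = fun=> 0) => [|]; [lra|apply/funext => x; lra].
have := pairing_lin a bmu bf b0; rewrite p0 addr0 => <-.
by congr pairing; apply/funext => x; rewrite addr0.
Qed.

Lemma pairing_indic mu M (A : set (borel X)) : bounded_additive mu M ->
  measurable A -> pairing mu \1_A = fine (mu A).
Proof.
move=> bmu mA; rewrite (pairing_simple bmu); first exact: sint_indic bmu mA.
exact: (simple_indic R mA).
Qed.

(** The bound involves only the mass inside [D].  Regularity is used in this form,
    with the gap between an open and a closed set for [D]. *)
Lemma pairing_le mu M D e K f : bounded_additive mu M -> measurable (D : set (borel X)) ->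
  0 <= K -> (forall C : set (borel X), measurable C -> C `<=` D -> (`|mu C| <= e%:E)%E) ->
  Bb f -> (forall x, D x -> `|f x| <= K) -> (forall x, ~ D x -> f x = 0) ->
  `|pairing mu f| <= 2 * e * K.
Proof.
move=> bmu mD K0 De bf fK f0; have M0 := bounded_additive_ge0 bmu.
have e0 : 0 <= e.
  by have := De _ measurable0 (sub0set _); rewrite (bounded_additive0 bmu) abse0 lee_fin.
rewrite -subr_le0; apply: (@le_scale0 _ (2 * e + 2 * M)) => [|d d0]; first lra.
have [s [ss sf]] := Bb_approx bf d0.
pose t x := s x * \1_D x; have st : @simple _ (borel X) R t.
  by apply: simple_mul => //; exact: simple_indic.
have tf x : `|t x - f x| <= d.
  rewrite /t indicE; have [xD|xD] := boolP (x \in D); first by rewrite mulr1.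
  by rewrite mulr0 f0 ?subrr ?normr0 ?ltW// => /mem_set; rewrite (negbTE xD).
have H1 := pairing_close bmu bf (ltW d0) st tf.
have H2 : `|sint mu t| <= 2 * e * (K + d).
  apply: (sint_le bmu mD) => //; first lra.
    move=> x Dx; have := tf x; have := fK _ Dx; rewrite !ler_norml.
    by move=> /andP[? ?] /andP[? ?]; apply/andP; split; lra.
  by move=> x Dx; rewrite /t indicE memNset// mulr0.
have := ler_distD (sint mu t) (pairing mu f) 0; rewrite !subr0 distrC.
move: H1 H2; nra.
Qed.

Lemma pairing_ge0 mu M f : bounded_additive mu M ->
  (forall A : set (borel X), measurable A -> (0 <= mu A)%E) -> Bb f -> (forall x, 0 <= f x) ->
  0 <= pairing mu f.
Proof.
move=> bmu mu0 bf f0; have M0 := bounded_additive_ge0 bmu.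
rewrite -oppr_le0; apply: (@le_scale0 _ (4 * M)) => [|e e0]; first lra.
have [s [ss sf]] := Bb_approx bf e0.
have sT := simple_indic R (measurableT : measurable [set: borel X]).
have ST := sint_indic bmu measurableT.
have H1 := pairing_close bmu bf (ltW e0) ss sf.
have : 0 <= sint mu (fun x => e * \1_setT x + s x).
  apply: (sint_ge0 bmu) => //; first exact: simple_lin.
  move=> x; rewrite indicE in_setT mulr1.
  by have := f0 x; have := sf x; rewrite ler_norml => /andP[? ?] ?; lra.
rewrite (sint_lin _ bmu)// ST.
have : fine (mu setT) <= M.
  have mT := bmu.2 _ measurableT; rewrite -lee_fin fineK ?(bounded_additive_fin bmu)//.
  by rewrite (le_trans _ mT)// lee_abs.
move: H1; rewrite ler_norml => /andP[? ?]; nra.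
Qed.

End pairing.

(** * The metric of the sequence space *)

Section metric_functions.
Context {R : realType} {T : metricType R}.
Implicit Types (f : T -> R) (A : set T).

Lemma near_mdist (x : T) (e : R) : 0 < e -> \forall y \near x, mdist x y < e.
Proof.
by move=> e0; apply/metricType_numDomainType.nbhs_mdistP; exists e.
Qed.

Lemma lipschitz_continuous f k : (forall x y, `|f x - f y| <= k * mdist x y) ->
  continuous f.
Proof.
move=> fk x; apply/cvgrPdist_le => e e0.
have K0 : 0 < `|k| + 1 by rewrite ltr_wpDl.
apply: filterS (near_mdist x (divr_gt0 e0 K0)) => y xy; apply: (le_trans (fk x y)).
apply: (@le_trans _ _ ((`|k| + 1) * mdist x y)).
  by rewrite ler_wpM2r ?mdist_ge0// (le_trans (ler_norm k))// lerDl.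
by rewrite mulrC -ler_pdivlMr// ltW.
Qed.

(** The distance is cut at [1], which makes it meaningful for the empty set. *)
Definition dist_to A (x : T) : R := inf ([set mdist x y | y in A] `|` [set 1]).

Let lb0 A x : lbound ([set mdist x y | y in A] `|` [set 1]) 0.
Proof. by move=> _ [[y _ <-]|->]; rewrite ?mdist_ge0. Qed.

Let has_inf_dist A x : has_inf ([set mdist x y | y in A] `|` [set 1]).
Proof. by split; [exists 1; right|exists 0; exact: lb0]. Qed.

Lemma dist_to_ge0 A x : 0 <= dist_to A x.
Proof. by apply: lb_le_inf; [exists 1; right|exact: lb0]. Qed.

Lemma dist_to_le1 A x : dist_to A x <= 1.
Proof. by apply: ge_inf; [exact: (has_inf_dist A x).2|right]. Qed.

Lemma dist_to_le A x y : A y -> dist_to A x <= mdist x y.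
Proof. by move=> Ay; apply: ge_inf; [exact: (has_inf_dist A x).2|left; exists y]. Qed.

Lemma dist_to0 A x : A x -> dist_to A x = 0.
Proof.
move=> Ax; apply/eqP; rewrite eq_le dist_to_ge0 andbT.
by rewrite (le_trans (dist_to_le x Ax))// mdistxx.
Qed.

Lemma dist_to_gt0 A x : closed A -> ~ A x -> 0 < dist_to A x.
Proof.
move=> cA nAx; have /metricType_numDomainType.nbhs_mdistP[e /= e0 eA] : nbhs x (~` A).
  by apply: open_nbhs_nbhs; split => //; exact: closed_openC.
apply: (@lt_le_trans _ _ (Num.min e 1)); first by rewrite lt_min e0 ltr01.
apply: lb_le_inf; first by exists 1; right.
move=> _ [[y Ay <-]|->]; last by rewrite ge_min lexx orbT.
rewrite ge_min leNgt; apply/orP; left; apply/negP => xy.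
exact: (eA _ xy).
Qed.

Lemma dist_to_lipschitz A x y : `|dist_to A x - dist_to A y| <= 1 * mdist x y.
Proof.
rewrite mul1r; have H u v : dist_to A u - dist_to A v <= mdist u v.
  rewrite lerBlDr -lerBlDl; apply: lb_le_inf; first by exists 1; right.
  move=> _ [[z Az <-]|->]; rewrite lerBlDl.
    by rewrite (le_trans (dist_to_le u Az))// metric_triangle.
  by rewrite (le_trans (dist_to_le1 A u))// lerDr mdist_ge0.
rewrite ler_norml H andbT; have := H y x; rewrite metric_sym; lra.
Qed.

End metric_functions.

Section sequence_space.
Context {R : realType} {E : metricType R}.
Local Notation X := (seq_space E).
Implicit Types x y : X.

Let term_ge0 x y n : 0 <= seq_dist_term x y n.
Proof. by rewrite mulr_ge0 ?exprn_ge0 ?invr_ge0// le_min mdist_ge0 ler01. Qed.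

Let series_term_le x y N n : series (seq_dist_term x y) n <=
  \sum_(i < N) Num.min (mdist (x i) (y i)) 1 + 2^-1 ^+ N.
Proof.
set m := fun i => Num.min (mdist (x i) (y i)) 1.
have m0 i : 0 <= m i by rewrite le_min mdist_ge0 ler01.
have H k : series (seq_dist_term x y) (N + k)%N <=
    \sum_(i < N) m i + (2^-1 ^+ N - 2^-1 ^+ (N + k)%N).
  elim: k => [|k ih].
    rewrite addn0 subrr /series/= big_mkord; rewrite addr0; apply: ler_sum => i _.
    by rewrite /seq_dist_term ler_piMl ?m0 ?exprn_ile1 ?invr_ge0 ?invf_le1 ?ler1n.
  rewrite addnS /series/= big_nat_recr//=; apply: (le_trans (lerD ih (lexx _))).
  have : seq_dist_term x y (N + k)%N <= 2^-1 ^+ (N + k).+1.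
    by rewrite ler_piMr ?exprn_ge0 ?invr_ge0// ge_min lexx orbT.
  by rewrite exprS; lra.
apply: (@le_trans _ _ (series (seq_dist_term x y) (N + n)%N)).
  by apply: nondecreasing_series => // ; rewrite leq_addl.
apply: (le_trans (H n)); rewrite lerD2l gerBl exprn_ge0// invr_ge0//.
Qed.

Let cvg_term x y : cvgn (series (seq_dist_term x y)).
Proof.
apply: nondecreasing_is_cvgn; first by apply: nondecreasing_series => i _ _.
exists (1 : R) => _ [n _ <-].
by apply: (le_trans (series_term_le x y 0 n)); rewrite big_ord0 add0r expr0.
Qed.

(** The coordinates from [N] on contribute at most the tail of the geometric
    series. *)
Lemma seq_dist_le x y N :
  mdist x y <= \sum_(i < N) Num.min (mdist (x i) (y i)) 1 + 2^-1 ^+ N.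
Proof.
by apply: limr_le; [exact: cvg_term|apply: nearW => n; exact: series_term_le].
Qed.

Lemma seq_dist_le1 x y : mdist x y <= 1.
Proof. by have := seq_dist_le x y 0; rewrite big_ord0 add0r expr0. Qed.

Lemma seq_dist_ge x y n : Num.min (mdist (x n) (y n)) 1 <= 2 ^+ n.+1 * mdist x y.
Proof.
rewrite mulrC -ler_pdivrMr ?exprn_gt0// mulrC -exprVn.
apply: (@le_trans _ _ (series (seq_dist_term x y) n.+1)).
  by rewrite /series/= big_nat_recr//= lerDr sumr_ge0.
apply: nondecreasing_cvgn_le; last exact: cvg_term.
by apply: nondecreasing_series => i _ _; exact: term_ge0.
Qed.

Lemma coordinate_continuous n : continuous (fun x : X => x n).
Proof.
move=> x; apply/(metricType_numDomainType.cvgrPdist_lt (FF := nbhs_filter x)) => e e0.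
pose d := Num.min e 1; have d0 : 0 < d by rewrite lt_min e0 ltr01.
have d2 : 0 < d / 2 ^+ n.+1 by rewrite divr_gt0// exprn_gt0.
apply: filterS (near_mdist x d2) => y; rewrite ltr_pdivlMr ?exprn_gt0// mulrC.
move=> /(le_lt_trans (seq_dist_ge x y n)); rewrite /d.
by rewrite /Num.min; case: ifPn => _; case: ifPn; lra.
Qed.

Lemma coordinatewise_cvg (I : Type) (F : set_system I) (u : I -> X) (y : X) :
  Filter F -> (forall n, u i n @[i --> F] --> y n) -> u @ F --> y.
Proof.
move=> FF uy; apply/metricType_numDomainType.cvgrPdist_lt => e e0.
have e2 : 0 < e / 2 by rewrite divr_gt0.
have [N _ Ne] : \forall N \near \oo, 2^-1 ^+ N < e / 2.
  have : (2^-1 ^+ n : R) @[n --> \oo] --> (0 : R).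
    by apply: cvg_expr; rewrite ger0_norm ?invr_ge0// invf_lt1// ltr1n.
  move/cvgrPdist_lt => /(_ _ e2); apply: filterS => n.
  by rewrite sub0r normrN ger0_norm// exprn_ge0// invr_ge0.
have d0 : 0 < e / 2 / N.+1%:R by rewrite divr_gt0.
have near_coord : \forall i \near F, forall n : 'I_N, mdist (y n) (u i n) < e / 2 / N.+1%:R.
  apply: filter_forall => n.
  by have /metricType_numDomainType.cvgr_dist_lt := uy n; apply.
apply: filterS near_coord => i ui; apply: (le_lt_trans (seq_dist_le _ _ N)).
rewrite (splitr e) ler_ltD//; last by apply: Ne => /=.
apply: (@le_trans _ _ (\sum_(n < N) (e / 2 / N.+1%:R))).
  by apply: ler_sum => n _; rewrite ge_min ltW.
rewrite sumr_const card_ord -[_ *+ N]mulr_natr mulrAC ler_pdivrMr//.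
by rewrite ler_wpM2l ?ltW// ltr_nat.
Qed.

Lemma shift_continuous : continuous (@Defs.shift R E).
Proof.
move=> x; apply: (coordinatewise_cvg (nbhs_filter x)) => n.
exact: (@coordinate_continuous n.+1 x).
Qed.

End sequence_space.

(** * Means on the bounded continuous functions *)

Section continuous_real_functions.
Context {R : realType} {T : topologicalType}.
Implicit Types f g : T -> R.

Lemma continuous_affine a f g : continuous f -> continuous g ->
  continuous (fun x => a * f x + g x).
Proof.
move=> cf cg x; apply: cvgD; last exact: cg.
by apply: cvgM; [exact: cvg_cst|exact: cf].
Qed.

Lemma continuous_normr f : continuous f -> continuous (fun x => `|f x|).
Proof. by move=> cf x; apply: cvg_norm; exact: cf. Qed.

End continuous_real_functions.

Section bounded_continuous.
Context {R : realType} {E : completeMetricType R}.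
Local Notation X := (seq_space E).
Implicit Types (f g : X -> R) (L : (X -> R) -> R).

Lemma CbI f K : continuous f -> (forall x, `|f x| <= K) -> Cb f.
Proof.
move=> cf fK; split=> //; exists K; split; first exact: num_real.
by move=> M /ltW KM x _; exact: le_trans (fK x) KM.
Qed.

Lemma Cb_bounded f : Cb f -> exists2 K, 0 <= K & forall x, `|f x| <= K.
Proof.
move=> /Cb_Bb[_ [K fK]]; exists K => //.
exact: le_trans (normr_ge0 _) (fK point).
Qed.

Lemma Cb_cst c : Cb (fun _ : X => c).
Proof. by apply: (@CbI _ `|c|) => [x|x]; [exact: cst_continuous|rewrite lexx]. Qed.

Lemma Cb_lin a f g : Cb f -> Cb g -> Cb (fun x => a * f x + g x).
Proof.
move=> fb gb; have [K _ fK] := Cb_bounded fb; have [K' _ gK] := Cb_bounded gb.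
apply: (@CbI _ (`|a| * K + K')) => [x|x].
  by apply: continuous_affine; [exact: fb.1|exact: gb.1].
by rewrite (le_trans (ler_normD _ _))// normrM lerD// ler_wpM2l.
Qed.

Lemma CbD f g : Cb f -> Cb g -> Cb (fun x => f x + g x).
Proof.
move=> fb gb; have := Cb_lin 1 fb gb.
by under eq_fun do rewrite mul1r.
Qed.

Lemma CbZ a f : Cb f -> Cb (fun x => a * f x).
Proof.
move=> fb; have := Cb_lin a fb (Cb_cst 0).
by under eq_fun do rewrite addr0.
Qed.

Lemma Cb_norm f : Cb f -> Cb (fun x => `|f x|).
Proof.
move=> fb; have [K _ fK] := Cb_bounded fb.
apply: (@CbI _ K) => [x|x]; last by rewrite normr_id.
by apply: continuous_normr; exact: fb.1.
Qed.

Lemma Cb_min f g : Cb f -> Cb g -> Cb (fun x => Num.min (f x) (g x)).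
Proof.
move=> fb gb.
have -> : (fun x => Num.min (f x) (g x)) =
    (fun x => - 2^-1 * `|-1 * f x + g x| + (2^-1 * f x + 2^-1 * g x)).
  apply/funext => x; rewrite /Num.min; case: ifPn => h.
    by rewrite ger0_norm; lra.
  by rewrite ler0_norm; lra.
apply: Cb_lin; first exact/Cb_norm/Cb_lin.
by apply: Cb_lin => //; exact: CbZ.
Qed.

Lemma Cb_max f g : Cb f -> Cb g -> Cb (fun x => Num.max (f x) (g x)).
Proof.
move=> fb gb.
have -> : (fun x => Num.max (f x) (g x)) =
    (fun x => -1 * Num.min (-1 * f x) (-1 * g x)).
  by apply/funext => x; rewrite /Num.max /Num.min; do 2 case: ifPn; lra.
by apply: CbZ; apply: Cb_min; exact: CbZ.
Qed.

Lemma Cb_sum n (f : nat -> X -> R) : (forall i, Cb (f i)) ->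
  Cb (fun x => \sum_(i < n) f i x).
Proof.
move=> fb; elim: n => [|n ih].
  by under eq_fun do rewrite big_ord0; exact: Cb_cst.
by under eq_fun do rewrite big_ord_recr/=; exact: CbD.
Qed.

Lemma Cb_shift f : Cb f -> Cb (f \o @Defs.shift R E).
Proof.
move=> fb; have [K _ fK] := Cb_bounded fb.
apply: (@CbI _ K) => [x|x]; last exact: fK.
by apply: continuous_comp; [exact: shift_continuous|exact: fb.1].
Qed.

(** The states of [Cb]: positive normalised functionals. *)
Definition mean L : Prop :=
  [/\ forall a f g, Cb f -> Cb g -> L (fun x => a * f x + g x) = a * L f + L g,
      forall f, Cb f -> (forall x, 0 <= f x) -> 0 <= L f & L (cst 1) = 1].

Section mean_theory.
Variables (L : (X -> R) -> R) (mL : mean L).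

Lemma meanD f g : Cb f -> Cb g -> L (fun x => f x + g x) = L f + L g.
Proof.
case: mL => lin _ _ fb gb; rewrite -[L f]mul1r -lin//.
by congr L; apply/funext => x; rewrite mul1r.
Qed.

Lemma mean0 : L (fun=> 0) = 0.
Proof.
have := meanD (Cb_cst 0) (Cb_cst 0).
by under eq_fun do rewrite addr0; lra.
Qed.

Lemma meanZ a f : Cb f -> L (fun x => a * f x) = a * L f.
Proof.
case: mL => lin _ _ fb; rewrite -[RHS]addr0 -mean0 -lin//; last exact: Cb_cst.
by congr L; apply/funext => x; rewrite addr0.
Qed.

Lemma mean_cst c : L (fun=> c) = c.
Proof.
case: mL => _ _ L1; rewrite -[RHS]mulr1 -L1 -meanZ; last exact: Cb_cst.
by congr L; apply/funext => x; rewrite mulr1.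
Qed.

Lemma le_mean f g : Cb f -> Cb g -> (forall x, f x <= g x) -> L f <= L g.
Proof.
case: mL => lin pos _ fb gb fg; rewrite -subr_ge0 addrC -mulN1r -lin//.
by apply: pos => [|x]; [exact: Cb_lin|have := fg x; lra].
Qed.

Lemma mean_sum n (f : nat -> X -> R) : (forall i, Cb (f i)) ->
  L (fun x => \sum_(i < n) f i x) = \sum_(i < n) L (f i).
Proof.
move=> fb; elim: n => [|n ih].
  by under eq_fun do rewrite big_ord0; rewrite big_ord0 mean0.
under eq_fun do rewrite big_ord_recr/=.
by rewrite meanD ?ih ?big_ord_recr//; exact: Cb_sum.
Qed.

Lemma mean_abs f K : Cb f -> (forall x, `|f x| <= K) -> `|L f| <= K.
Proof.
move=> fb fK; rewrite ler_norml -{1}(mean_cst (- K)) -{2}(mean_cst K).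
apply/andP; split; apply: le_mean => //; try exact: Cb_cst.
  by move=> x; have := fK x; rewrite ler_norml => /andP[].
by move=> x; have := fK x; rewrite ler_norml => /andP[].
Qed.

End mean_theory.

(** Daniell's continuity condition, which separates the functionals given by
    countably additive measures from the other means. *)
Definition sigma_smooth L : Prop := forall phi : nat -> X -> R,
  (forall n, Cb (phi n)) -> (forall n x, 0 <= phi n.+1 x <= phi n x) ->
  (forall x, phi n x @[n --> \oo] --> 0) ->
  forall e, 0 < e -> exists n, L (phi n) <= e.

End bounded_continuous.

(** The layers of the decomposition used in [le_riesz_pairing]. *)
Lemma sum_clamp (R : realType) (n : nat) (y : R) : 0 <= y ->
  \sum_(k < n) Num.min 1 (Num.max 0 (y - k%:R)) = Num.min n%:R y.
Proof.
move=> y0; elim: n => [|n ih]; first by rewrite big_ord0 min_l.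
rewrite big_ord_recr/= ih -natr1; have [yn|ny] := leP y n%:R.
  by rewrite max_l ?subr_le0// min_r// addr0 min_r//; lra.
rewrite max_r ?subr_ge0 ?(ltW ny)//; have [ny1|ny1] := leP 1 (y - n%:R).
  by rewrite min_l//; lra.
by rewrite min_r; lra.
Qed.

Lemma sum_indic_lt (R : realType) (n : nat) (y : R) : 0 <= y ->
  \sum_(k < n) (k%:R < y)%R%:R <= y + 1 :> R.
Proof.
move=> y0; elim: n => [|n ih]; first by rewrite big_ord0 addr_ge0.
rewrite big_ord_recr/=; case: (ltP n%:R y) => ny; last by rewrite addr0.
apply: (@le_trans _ _ (\sum_(k < n) 1 + 1)).
  by rewrite lerD2r; apply: ler_sum => k _; rewrite lern1 leq_b1.
by rewrite sumr_const card_ord lerD2r ltW.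
Qed.

(** * Riesz representation of a sigma-smooth mean *)

Section riesz.
Context {R : realType} {E : completeMetricType R}.
Local Notation X := (seq_space E).
Variables (L : (X -> R) -> R) (mL : mean L) (sL : sigma_smooth L).
Implicit Types (f g : X -> R) (U A : set X).

Definition below U : set (X -> R) :=
  [set f | Cb f /\ forall x, 0 <= f x <= \1_U x].

Definition inner_content U : \bar R := ereal_sup [set (L f)%:E | f in below U].

Definition outer_content A : \bar R :=
  ereal_inf [set inner_content U | U in [set U | open U /\ A `<=` U]].

Let below0 U : below U (fun=> 0).
Proof. by split; [exact: Cb_cst|move=> x; rewrite lexx indicE ler0n]. Qed.

Lemma inner_content_ge U f : below U f -> ((L f)%:E <= inner_content U)%E.
Proof. by move=> Uf; apply: ereal_sup_ubound; exists f. Qed.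

Lemma inner_content_ge0 U : (0 <= inner_content U)%E.
Proof. by have := inner_content_ge (below0 U); rewrite (mean0 mL). Qed.

Lemma inner_content_le1 U : (inner_content U <= 1)%E.
Proof.
apply: ge_ereal_sup => _ [f [fb f01] <-]; rewrite lee_fin.
rewrite -(mean_cst mL 1); apply: (le_mean mL) => //; first exact: Cb_cst.
by move=> x; have /andP[_ /le_trans] := f01 x; apply; rewrite indicE lern1 leq_b1.
Qed.

Lemma le_inner_content U V : U `<=` V -> (inner_content U <= inner_content V)%E.
Proof.
move=> UV; apply: ge_ereal_sup => _ [f [fb f01] <-]; apply: inner_content_ge.
split=> // x; have /andP[-> /le_trans] := f01 x; apply.
rewrite !indicE ler_nat; case: (boolP (x \in U)) => // /set_mem/UV/mem_set ->//.
Qed.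

Lemma outer_content_le A U : open U -> A `<=` U ->
  (outer_content A <= inner_content U)%E.
Proof. by move=> oU AU; apply: ereal_inf_lbound; exists U. Qed.

Lemma outer_content_open U : open U -> outer_content U = inner_content U.
Proof.
move=> oU; apply/eqP; rewrite eq_le outer_content_le//=.
by apply: le_ereal_inf_tmp => _ [V [oV UV] <-]; exact: le_inner_content.
Qed.

Lemma outer_content_ge0 A : (0 <= outer_content A)%E.
Proof. by apply: le_ereal_inf_tmp => _ [U _ <-]; exact: inner_content_ge0. Qed.

Lemma outer_content_le1 A : (outer_content A <= 1)%E.
Proof.
apply: le_trans (inner_content_le1 setT).
by apply: outer_content_le => //; exact: openT.
Qed.

Lemma outer_content_fin A : outer_content A \is a fin_num.
Proof.
rewrite ge0_fin_numE ?outer_content_ge0//.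
by rewrite (le_lt_trans (outer_content_le1 A))// ltry.
Qed.

Lemma outer_content_approx A e : 0 < e ->
  exists U, [/\ open U, A `<=` U & (inner_content U <= outer_content A + e%:E)%E].
Proof.
move=> e0; have [_ [U [oU AU] <-] /ltW Ue] := lb_ereal_inf_adherent e0 (outer_content_fin A).
by exists U.
Qed.

Lemma outer_content0 : outer_content set0 = 0%E.
Proof.
apply/eqP; rewrite eq_le outer_content_ge0 andbT.
apply: le_trans (outer_content_le open0 (@subset_refl _ _)) _.
apply: ge_ereal_sup => _ [f [fb f01] <-]; rewrite lee_fin.
rewrite -(mean_cst mL 0); apply: (le_mean mL) => //; first exact: Cb_cst.
by move=> x; have := f01 x; rewrite indic0 => /andP[].
Qed.

Lemma le_outer_content A A' : A `<=` A' -> (outer_content A <= outer_content A')%E.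
Proof.
move=> AA'; apply: le_ereal_inf_tmp => _ [U [oU A'U] <-].
by apply: outer_content_le => //; exact: subset_trans A'U.
Qed.

(** Bounded continuous functions increasing to the indicator of an open set. *)
Definition open_approx U (k : nat) (x : X) : R :=
  Num.min 1 (k%:R * dist_to (~` U) x).

Lemma Cb_dist_to A : Cb (dist_to A).
Proof.
apply: (@CbI _ _ _ 1) => [|x].
  exact: lipschitz_continuous (@dist_to_lipschitz _ _ A).
by rewrite ger0_norm ?dist_to_ge0// dist_to_le1.
Qed.

Lemma below_open_approx U k : below U (open_approx U k).
Proof.
split; first by apply: Cb_min; [exact: Cb_cst|apply: CbZ; exact: Cb_dist_to].
move=> x; rewrite /open_approx le_min ler01 mulr_ge0 ?dist_to_ge0//= indicE.
have [xU|xU] := boolP (x \in U); first by rewrite ge_min lexx.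
rewrite (_ : dist_to _ x = 0) ?mulr0 ?ge_min ?lexx ?orbT//.
by apply: dist_to0 => /mem_set; apply/negP.
Qed.

Lemma open_approx1 U x : open U -> U x -> \forall k \near \oo, open_approx U k x = 1.
Proof.
move=> oU Ux; have d0 : 0 < dist_to (~` U) x.
  by apply: dist_to_gt0; [exact: open_closedC|].
near=> k; rewrite /open_approx min_l// -ler_pdivrMr//.
by near: k; exact: nbhs_infty_ger.
Unshelve. all: by end_near. Qed.

Lemma le_open_approx U k x : open_approx U k x <= open_approx U k.+1 x.
Proof.
rewrite /open_approx le_min ge_min lexx/= ge_min; apply/orP; right.
by rewrite ler_wpM2r ?dist_to_ge0// ler_nat.
Qed.

(** This is where sigma-smoothness enters: a function below the union is the
    increasing limit of its minima with finite sums of functions below the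
    members of the union. *)
Lemma inner_content_bigcup (U : nat -> set X) : (forall n, open (U n)) ->
  (inner_content (\bigcup_n U n) <= \sum_(n <oo) inner_content (U n))%E.
Proof.
move=> oU; apply: ge_ereal_sup => _ [f [fb f01] <-].
apply/lee_addgt0Pr => e e0.
pose S k x := \sum_(n < k) open_approx (U n) k x.
have Sb k : Cb (S k).
  apply: (@Cb_sum _ _ k (fun n => open_approx (U n) k)) => n.
  exact: (below_open_approx _ _).1.
have S0 k n x : 0 <= open_approx (U n) k x.
  by have /andP[] := (below_open_approx (U n) k).2 x.
have Smono k x : S k x <= S k.+1 x.
  rewrite /S big_ord_recr/= ler_wpDr ?S0//.
  by apply: ler_sum => n _; exact: le_open_approx.
pose F k x := f x - Num.min (f x) (S k x).
have minb k : Cb (fun x => Num.min (f x) (S k x)) by exact: Cb_min.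
have Fb k : Cb (F k).
  have := Cb_lin (-1) (minb k) fb.
  by under eq_fun do rewrite mulN1r addrC.
have F0 k x : 0 <= F k.+1 x <= F k x.
  rewrite subr_ge0 ge_min lexx/= lerB// le_min ge_min lexx/= ge_min.
  by rewrite Smono orbT.
have [k Lk] : exists k, L (F k) <= e.
  apply: sL => // x; apply: cvg_near_cst.
  have [[n _ Unx]|nU] := pselect ((\bigcup_n U n) x).
    near=> k; have S1 : 1 <= S k x.
      have nk : (n < k)%N by near: k; exact: nbhs_infty_gt.
      rewrite /S (bigD1 (Ordinal nk))//= (_ : open_approx _ _ _ = 1); last first.
        by near: k; exact: open_approx1.
      by rewrite lerDl sumr_ge0.
    rewrite /F min_l ?subrr//; apply: le_trans S1.
    by have /andP[_ /le_trans] := f01 x; apply; rewrite indicE lern1 leq_b1.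
  apply: nearW => k; rewrite /F min_l ?subrr// (_ : f x = 0) ?sumr_ge0//.
  by have := f01 x; rewrite indicE memNset// => ?; apply/eqP; rewrite eq_le andbC.
have LE : L f = L (F k) + L (fun x => Num.min (f x) (S k x)).
  rewrite -(meanD mL)//; congr L; apply/funext => x; rewrite /F; lra.
have LS : L (fun x => Num.min (f x) (S k x)) <=
    \sum_(n < k) L (open_approx (U n) k).
  rewrite -(@mean_sum _ _ _ mL k (fun n => open_approx (U n) k)); last first.
    by move=> n; exact: (below_open_approx _ _).1.
  by apply: (le_mean mL (minb k) (Sb k)) => x; rewrite ge_min lexx orbT.
apply: (@le_trans _ _ (\sum_(n < k) inner_content (U n) + e%:E)%E); last first.
  rewrite leeD2r// -(big_mkord xpredT (fun n => inner_content (U n))).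
  by apply: nneseries_lim_ge => n _ _; exact: inner_content_ge0.
rewrite LE EFinD addeC leeD ?lee_fin//.
apply: (@le_trans _ _ (\sum_(n < k) (L (open_approx (U n) k))%:E)%E).
  by rewrite sumEFin lee_fin.
by apply: lee_sum => n _; apply: inner_content_ge; exact: below_open_approx.
Unshelve. all: by end_near. Qed.

Lemma outer_content_sigma_subadditive : sigma_subadditive outer_content.
Proof.
move=> A; apply/lee_addgt0Pr => e e0.
have en0 n : 0 < e / (2 ^ n.+1)%:R by rewrite divr_gt0// ltr0n expn_gt0.
have /choice[U UP] := fun n => outer_content_approx (A n) (en0 n).
apply: le_trans (epsilon_trick _ _ (ltW e0)); last first.
  by move=> n; exact: outer_content_ge0.
apply: (@le_trans _ _ (\sum_(n <oo) inner_content (U n))%E); last first.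
  apply: lee_nneseries => [n _ _|n _]; first exact: inner_content_ge0.
  by have [] := UP n.
apply: le_trans (inner_content_bigcup _); last by move=> n; have [] := UP n.
apply: outer_content_le; first by apply: bigcup_open => n _; have [] := UP n.
by apply: subset_bigcup => n _; have [] := UP n.
Qed.

HB.instance Definition _ := isOuterMeasure.Build R X outer_content
  outer_content0 outer_content_ge0 le_outer_content outer_content_sigma_subadditive.

Lemma inner_content_fin U : inner_content U \is a fin_num.
Proof.
rewrite ge0_fin_numE ?inner_content_ge0//.
by rewrite (le_lt_trans (inner_content_le1 U))// ltry.
Qed.

Lemma inner_content_approx U e : 0 < e ->
  exists2 f, below U f & (inner_content U <= (L f + e)%:E)%E.
Proof.
move=> e0; have [_ [f Uf <-]] := ub_ereal_sup_adherent e0 (inner_content_fin U).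
by rewrite lteBlDr// => /ltW ?; exists f.
Qed.

(** An almost optimal function below [V `&` U], cut down by a small constant,
    vanishes outside a closed set [F] contained in [V `&` U]; its sum with an
    almost optimal function below the open set [V `\` F] is still below [V]. *)
Lemma open_caratheodory U : open U -> outer_content.-caratheodory U.
Proof.
move=> oU; apply: le_caratheodory_measurable => A.
apply/lee_addgt0Pr => e e0; have e4 : 0 < e / 4 by rewrite divr_gt0.
have [V [oV AV Ve]] := outer_content_approx A e4.
have [f [fb f01] fU] := inner_content_approx (V `&` U) e4.
pose F := [set x | e / 4 <= f x].
have cF : closed F.
  rewrite (_ : F = f @^-1` [set y | e / 4 <= y])//.
  by apply: closed_comp => [x _|]; [exact: fb.1|exact: closed_ge].
have FVU : F `<=` V `&` U.
  move=> x Fx; apply: contrapT => nVU; move: Fx; rewrite /F/=.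
  by have := f01 x; rewrite indicE memNset//= => /andP[_ ?]; lra.
have oVF : open (V `\` F) by rewrite setDE; apply: openI => //; exact: closed_openC.
have [g [gb g01] gV] := inner_content_approx (V `\` F) e4.
pose h x := Num.max (f x - e / 4) 0 + g x.
have fe : Cb (fun x => f x - e / 4) by exact: CbD fb (Cb_cst _).
have hV : below V h.
  split; first by apply: CbD => //; apply: Cb_max => //; exact: Cb_cst.
  move=> x; have := f01 x; have := g01 x; rewrite /h !indicE.
  have [Fx|Fx] := pselect (F x).
    have [Vx Ux] := FVU _ Fx.
    rewrite (memNset (_ : ~ (V `\` F) x)); last by move=> [].
    rewrite !mem_set//= mulr0n mulr1n => /andP[? ?] /andP[? ?].
    by rewrite /Num.max; case: ltP => ?; apply/andP; split; lra.
  have {}Fx : f x < e / 4 by rewrite ltNge; apply/negP.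
  rewrite max_r ?add0r; last by lra.
  move=> /andP[-> /le_trans gx] _; apply: gx.
  rewrite ler_nat; case: (boolP (x \in V `\` F)) => // /set_mem[Vx _].
  by rewrite mem_set.
have Lh : L f + L g <= L h + e / 4.
  rewrite -(meanD mL fb gb) -[e / 4](mean_cst mL) -(meanD mL hV.1 (Cb_cst _)).
  apply: (le_mean mL); [exact: CbD|by apply: CbD; [exact: hV.1|exact: Cb_cst]|].
  by move=> x; rewrite /h /Num.max; case: ifPn; lra.
have H1 : (outer_content (A `&` U) <= (L f + e / 4)%:E)%E.
  by apply: le_trans fU; apply: outer_content_le; [exact: openI|exact: setSI].
have H2 : (outer_content (A `&` ~` U) <= (L g + e / 4)%:E)%E.
  apply: le_trans gV; apply: outer_content_le => // x [/AV Vx nUx]; split => //.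
  by move=> /FVU[].
apply: (le_trans (leeD H1 H2)).
apply: (@le_trans _ _ ((L h)%:E + (3 * (e / 4))%:E)%E).
  by rewrite -!EFinD lee_fin; lra.
apply: (@le_trans _ _ (outer_content A + (e / 4)%:E + (3 * (e / 4))%:E)%E).
  by rewrite leeD2r// (le_trans (inner_content_ge hV)).
by rewrite -addeA -EFinD leeD2l// lee_fin; lra.
Qed.

(** By Caratheodory's theorem the outer content is additive on the Borel sets;
    the approximation by open sets from outside, applied to a set and to its
    complement, is the regularity required by [rba]. *)
Lemma borel_caratheodory (A : set (borel X)) : measurable A ->
  outer_content.-caratheodory A.
Proof.
move: A; apply: smallest_sub; last by move=> U; exact: open_caratheodory.
split; first exact: caratheodory_measurable_set0.
- by move=> A mA; rewrite setTD; exact: caratheodory_measurable_setC.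
- exact: caratheodory_measurable_bigcup.
Qed.

Definition borel_content : set (borel X) -> \bar R := outer_content.

Let borel_content_fin : fin_num_fun borel_content.
Proof. by move=> A _; exact: outer_content_fin. Qed.

Let borel_content_additive : measure_function.semi_additive borel_content.
Proof.
move=> F n mF tF _; rewrite /borel_content -[X in outer_content X]setTI.
rewrite caratheodory_additive//; last by move=> k; exact: borel_caratheodory.
by apply: eq_bigr => i _; rewrite setTI.
Qed.

HB.instance Definition _ :=
  isFinite.Build _ (borel X) R borel_content borel_content_fin.
HB.instance Definition _ :=
  isAdditiveCharge.Build _ (borel X) R borel_content borel_content_additive.

Definition riesz_charge : {additive_charge set (borel X) -> \bar R} := borel_content.

Lemma riesz_bounded : bounded_additive (riesz_charge : set (borel X) -> \bar R) 1.
Proof.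
split; first exact: borel_content_additive.
by move=> A _; rewrite gee0_abs ?outer_content_ge0// outer_content_le1.
Qed.

Lemma riesz_rba : rba riesz_charge.
Proof.
split; first by exists 1; exact: riesz_bounded.2.
move=> A mA e e0; have e2 : 0 < e / 3 by rewrite divr_gt0.
have [U [oU AU Ue]] := outer_content_approx A e2.
have [V [oV AV Ve]] := outer_content_approx (~` A) e2.
have diff (B W : set X) : measurable (B : set (borel X)) -> B `<=` W ->
    open W -> (inner_content W <= outer_content B + (e / 3)%:E)%E ->
    (outer_content (W `\` B) <= (e / 3)%:E)%E.
  move=> mB BW oW; rewrite -outer_content_open// (borel_caratheodory mB W).
  rewrite setIC (setIidl BW) -setDE leeD2lE//; exact: outer_content_fin.
exists (~` V), U; split => //; first exact: open_closedC.
  by rewrite -[A]setCK; exact: subsetC.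
move=> C mC CUV; rewrite gee0_abs ?outer_content_ge0//.
have : (outer_content C <= outer_content (U `\` A) + outer_content (V `\` ~` A))%E.
  apply: le_trans (outer_measureU2 _ _ _); apply: le_outer_content => x /CUV[Ux /contrapT Vx].
  have [Ax|nAx] := pselect (A x).
    by right; split=> //; apply.
  by left.
move=> /le_lt_trans; apply.
apply: (@le_lt_trans _ _ ((e / 3)%:E + (e / 3)%:E)%E).
  by rewrite leeD//; apply: diff => //; exact: measurableC.
by rewrite -EFinD lte_fin; lra.
Qed.

Let mu := (riesz_charge : set (borel X) -> \bar R).

Let muE A : mu A = outer_content A. Proof. by []. Qed.

Let open_borel (U : set X) : open U -> measurable (U : set (borel X)).
Proof. by move=> oU; exact: sub_sigma_algebra. Qed.

Let muT : mu setT = 1%E.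
Proof.
apply/eqP; rewrite eq_le muE outer_content_le1/= outer_content_open; last exact: openT.
have <- : (L (cst 1))%:E = 1%E by case: mL => _ _ ->.
apply: inner_content_ge; split; first exact: Cb_cst.
by move=> x; rewrite /= indicE mem_set// ler01 lexx.
Qed.

Let pairing_mono f g : Bb f -> Bb g -> (forall x, f x <= g x) ->
  pairing mu f <= pairing mu g.
Proof.
move=> bf bg fg; have := pairing_lin (-1) riesz_bounded bf bg.
have : 0 <= pairing mu (fun x => -1 * f x + g x).
  apply: (pairing_ge0 riesz_bounded (fun B _ => outer_content_ge0 B)) => [|x].
    exact: Bb_lin.
  by have := fg x; lra.
by rewrite -/mu; lra.
Qed.

Let pairing1 : pairing mu (cst 1) = 1.
Proof. by rewrite -indicT (pairing_indic riesz_bounded)// -/mu muT. Qed.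

Let Bb_cst c : Bb (fun _ : X => c). Proof. exact/Cb_Bb/Cb_cst. Qed.

Let pairing_cst c : pairing mu (fun=> c) = c.
Proof.
rewrite -[RHS]mulr1 -pairing1 -(pairingZ _ riesz_bounded (Bb_cst 1)).
by congr pairing; apply/funext => x; rewrite mulr1.
Qed.

(** Cutting [f] into [n] layers of height [1 / n]: the functional of a layer is
    at most the content of the open set where the layer does not vanish. *)
Lemma le_riesz_pairing f : Cb f -> (forall x, 0 <= f x <= 1) -> L f <= pairing mu f.
Proof.
move=> fb f01; apply/ler_addgt0Pr => e e0.
pose n := `|Num.ceil e^-1|%N.+1.
have n0 : 0 < n%:R :> R by [].
have ne : n%:R^-1 <= e.
  rewrite invf_ple ?posrE// (le_trans (ceil_ge _))//.
  rewrite /n -natr1 natr_absz ger0_norm ?lerDl//.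
  by rewrite -(ler_int R) (le_trans _ (ceil_ge _))// invr_ge0 ltW.
apply: (@le_trans _ _ (pairing mu f + n%:R^-1)); last by rewrite lerD2l.
rewrite -(ler_pM2l n0) mulrDr mulfV ?gt_eqF//.
pose U k := [set x | k%:R < n%:R * f x].
have oU k : open (U k).
  have /continuousP cnf : continuous (fun x => n%:R * f x) by exact: (CbZ _ fb).1.
  exact: (cnf _ (@open_gt R k%:R)).
pose l k x := Num.min 1 (Num.max 0 (n%:R * f x - k%:R)).
have lU k : below (U k) (l k).
  split.
    apply: Cb_min; [exact: Cb_cst|apply: Cb_max; first exact: Cb_cst].
    by apply: CbD; [exact: CbZ|exact: Cb_cst].
  move=> x; rewrite /l indicE; have [xU|xU] := boolP (x \in U k).
    by rewrite le_min ler01 le_max lexx/= ge_min lexx.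
  have : n%:R * f x <= k%:R by rewrite leNgt; apply/negP => /mem_set; apply/negP.
  by rewrite -subr_le0 => ?; rewrite max_l// min_r// lexx.
have -> : n%:R * L f = \sum_(k < n) L (l k).
  rewrite -(meanZ mL)// -(mean_sum mL)//; last by move=> k; exact: (lU k).1.
  congr L; apply/funext => x; rewrite sum_clamp; last first.
    by have /andP[? _] := f01 x; rewrite mulr_ge0.
  by rewrite min_r// ler_piMr//; have /andP[] := f01 x.
have bU k : Bb (\1_(U k) : X -> R).
  by apply: simple_Bb; apply: simple_indic; exact: open_borel.
have bsum m : Bb (fun x => \sum_(k < m) \1_(U k) x) /\
    pairing mu (fun x => \sum_(k < m) \1_(U k) x) = \sum_(k < m) fine (mu (U k)).
  elim: m => [|m [bs ps]].
    under eq_fun do rewrite big_ord0; rewrite big_ord0; split; first exact: Bb_cst.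
    have := pairingZ 0 riesz_bounded (Bb_cst 0).
    by under eq_fun do rewrite mul0r; rewrite mul0r.
  under eq_fun do rewrite big_ord_recr/= addrC -[\1_(U m) _]mul1r.
  split; first exact: Bb_lin.
  rewrite (pairing_lin _ riesz_bounded)// ps big_ord_recr/= mul1r addrC.
  by rewrite (pairing_indic riesz_bounded)//; exact: open_borel.
have H1 : \sum_(k < n) L (l k) <= \sum_(k < n) fine (mu (U k)).
  apply: ler_sum => k _; rewrite -lee_fin fineK; last exact: outer_content_fin.
  by rewrite muE outer_content_open//; exact: inner_content_ge.
apply: (le_trans H1); rewrite -(bsum n).2.
have bf := Cb_Bb fb.
have <- : pairing mu (fun x => n%:R * f x + 1) = n%:R * pairing mu f + 1.
  by rewrite (pairing_lin n%:R riesz_bounded bf (Bb_cst 1)) -/mu pairing_cst.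
apply: pairing_mono; [exact: (bsum n).1|by apply: Bb_lin => //; exact: Bb_cst|].
move=> x /=; apply: (@le_trans _ _ (\sum_(k < n) (k%:R < n%:R * f x)%R%:R)); last first.
  by apply: sum_indic_lt; have /andP[? _] := f01 x; rewrite mulr_ge0.
apply: ler_sum => k _; rewrite indicE ler_nat.
by case: (boolP (x \in U k)) => // /set_mem ->.
Qed.

(** The reverse inequality follows by passing to [1 - f]. *)
Lemma riesz_pairing f : Cb f -> pairing mu f = L f.
Proof.
have unit g : Cb g -> (forall x, 0 <= g x <= 1) -> pairing mu g = L g.
  move=> gb g01; apply/eqP; rewrite eq_le le_riesz_pairing// andbT.
  have gb' : Cb (fun x => -1 * g x + 1) by apply: Cb_lin => //; exact: Cb_cst.
  have := le_riesz_pairing gb'.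
  rewrite (pairing_lin (-1) riesz_bounded (Cb_Bb gb) (Bb_cst 1)) -/mu pairing_cst.
  case: (mL) => lin _ _; rewrite (lin (-1) _ _ gb (Cb_cst 1)) (mean_cst mL).
  have h x : 0 <= -1 * g x + 1 <= 1.
    by have /andP[? ?] := g01 x; apply/andP; split; lra.
  by move=> /(_ h); lra.
move=> fb; have [K K0 fK] := Cb_bounded fb.
have K1 : 0 < 2 * K + 1 by lra.
pose g x := (2 * K + 1)^-1 * f x + K / (2 * K + 1).
have gb : Cb g by apply: Cb_lin => //; exact: Cb_cst.
have g01 x : 0 <= g x <= 1.
  have := fK x; rewrite ler_norml => /andP[? ?].
  rewrite /g mulrC -mulrDl ler_pdivrMr// divr_ge0 ?(ltW K1)//=; lra.
have := unit g gb g01.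
rewrite (pairing_lin _ riesz_bounded (Cb_Bb fb) (Bb_cst _)) -/mu pairing_cst.
case: (mL) => lin _ _; rewrite (lin _ _ _ fb (Cb_cst _)) (mean_cst mL).
by move=> /addIr/(mulfI _); apply; rewrite invr_neq0// gt_eqF.
Qed.

End riesz.

(** * Charges as functionals *)

Lemma continuous_div {R : realType} {T : topologicalType} (f g : T -> R) :
  continuous f -> continuous g -> (forall x, g x != 0) ->
  continuous (fun x => f x / g x).
Proof.
move=> cf cg g0 x; apply: cvgM; first exact: cf.
by apply: cvgV => //; exact: cg.
Qed.

Section charges.
Context {R : realType} {E : completeMetricType R}.
Local Notation X := (seq_space E).
Local Notation charges := ({additive_charge set (borel X) -> \bar R}).
Implicit Types (mu nu : charges) (f g : X -> R).

Lemma rba_bounded_additive mu : rba mu -> exists M, bounded_additive mu M.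
Proof. by move=> [[M bM] _]; exists M; split. Qed.

Lemma M1a_mean mu : M1a mu -> mean (pairing mu).
Proof.
move=> [/rba_bounded_additive[M bmu] mu1 mupos]; split => //.
by move=> a f g fb gb; apply: (pairing_lin a bmu); exact: Cb_Bb.
Qed.

Lemma urysohn_Cb (F U : set X) : closed F -> open U -> F `<=` U ->
  exists phi, [/\ Cb phi, forall x, 0 <= phi x <= 1,
    forall x, F x -> phi x = 1 & forall x, ~ U x -> phi x = 0].
Proof.
move=> cF oO FO.
pose q := @dist_to R X (~` U); pose r := @dist_to R X F.
have q0 x : 0 <= q x by exact: dist_to_ge0.
have r0 x : 0 <= r x by exact: dist_to_ge0.
have qr x : 0 < q x + r x.
  have [Ox|nOx] := pselect (U x).
    by rewrite ltr_pwDl// dist_to_gt0//; exact: open_closedC.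
  by rewrite ltr_wpDl// dist_to_gt0// => /FO.
have qr1 x : 0 <= q x / (q x + r x) <= 1.
  by rewrite divr_ge0 ?(ltW (qr x))//= ler_pdivrMr// mul1r lerDl.
have cq : continuous q := @lipschitz_continuous _ _ _ _ (@dist_to_lipschitz _ _ _).
have cr : continuous r := @lipschitz_continuous _ _ _ _ (@dist_to_lipschitz _ _ _).
exists (fun x => q x / (q x + r x)); split => //.
- apply: (@CbI _ _ _ 1) => [|x]; last by rewrite ger0_norm; case/andP: (qr1 x).
  apply: continuous_div => // [|x]; last by rewrite gt_eqF.
  by have := @continuous_affine _ _ 1 _ _ cq cr; under eq_fun do rewrite mul1r.
- move=> x Fx; rewrite (_ : r x = 0) ?addr0 ?divff//; last exact: dist_to0.
  by have := qr x; rewrite (_ : r x = 0) ?addr0 => [/gt_eqF -> //|]; exact: dist_to0.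
- by move=> x nOx; rewrite (_ : q x = 0) ?mul0r//; exact: dist_to0.
Qed.

(** A continuous function squeezed between a closed and an open set that
    differ by little mass computes the charge of the closed set. *)
Lemma pairing_between mu (F U : set X) e phi : rba mu -> closed F -> open U ->
  F `<=` U -> (forall C : set (borel X), measurable C -> C `<=` U `\` F ->
    (`|mu C| <= e%:E)%E) ->
  Cb phi -> (forall x, 0 <= phi x <= 1) -> (forall x, F x -> phi x = 1) ->
  (forall x, ~ U x -> phi x = 0) -> `|pairing mu phi - fine (mu F)| <= 2 * e.
Proof.
move=> /rba_bounded_additive[M bmu] cF oO FO mue phib phi01 phiF phiO.
have mF : measurable (F : set (borel X)).
  by rewrite -[F]setCK; apply: measurableC; apply: sub_sigma_algebra; exact: closed_openC.
have mO : measurable (U : set (borel X)) by exact: sub_sigma_algebra.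
have bF : Bb (\1_F : X -> R) by apply: simple_Bb; exact: simple_indic.
have := pairing_lin (-1) bmu bF (Cb_Bb phib).
rewrite (pairing_indic bmu mF) mulN1r addrC => <-.
rewrite -[2 * e]mulr1; apply: (pairing_le bmu (measurableD mO mF)) => //.
- by apply: Bb_lin => //; exact: Cb_Bb.
- move=> x [Ox nFx]; rewrite indicE memNset// mulr0 add0r.
  by have /andP[? ?] := phi01 x; rewrite ger0_norm.
- move=> x nOFx; have [Fx|nFx] := pselect (F x).
    by rewrite indicE mem_set// mulr1 phiF// addNr.
  by rewrite indicE memNset// mulr0 add0r phiO// => Ox; apply: nOFx.
Qed.

(** Regularity makes a charge determined by the functional that it induces. *)
Lemma rba_unique mu nu : rba mu -> rba nu ->
  (forall f, Cb f -> pairing mu f = pairing nu f) ->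
  forall A : set (borel X), measurable A -> mu A = nu A.
Proof.
move=> rmu rnu mn A mA.
have [M bmu] := rba_bounded_additive rmu; have [N bnu] := rba_bounded_additive rnu.
suff mnA : fine (mu A) = fine (nu A).
  by rewrite -(fineK (bounded_additive_fin bmu mA)) mnA fineK// (bounded_additive_fin bnu mA).
apply/eqP; rewrite -subr_eq0 -normr_le0.
apply: (@le_scale0 _ 6) => // e e0.
have [F1 [U1 [cF1 FA1 oO1 AO1 small1]]] := rmu.2 A mA e e0.
have [F2 [U2 [cF2 FA2 oO2 AO2 small2]]] := rnu.2 A mA e e0.
pose F := F1 `|` F2; pose U := U1 `&` U2.
have cF : closed F by exact: closedU.
have oO : open U by exact: openI.
have FA : F `<=` A by move=> x [/FA1|/FA2].
have AO : A `<=` U by move=> x Ax; split; [exact: AO1|exact: AO2].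
have FO : F `<=` U := subset_trans FA AO.
have mF : measurable (F : set (borel X)).
  by rewrite -[F]setCK; apply: measurableC; apply: sub_sigma_algebra; exact: closed_openC.
have sub1 : U `\` F `<=` U1 `\` F1.
  by move=> x [[? ?] nF]; split => // ?; apply: nF; left.
have sub2 : U `\` F `<=` U2 `\` F2.
  by move=> x [[? ?] nF]; split => // ?; apply: nF; right.
have close (la : charges) : rba la ->
    (forall C : set (borel X), measurable C -> C `<=` U `\` F -> (`|la C| < e%:E)%E) ->
    `|fine (la A) - fine (la F)| <= e.
  move=> /rba_bounded_additive[K bla] small.
  have mAF : measurable ((A `\` F) : set (borel X)) by exact: measurableD.
  have lafin (B : set (borel X)) : measurable B -> la B \is a fin_num.
    exact: (bounded_additive_fin bla).
  have -> : fine (la A) - fine (la F) = fine (la (A `\` F)).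
    rewrite -{1}(setDUK FA) (bounded_additiveU bla)//; first by rewrite addrC addKr.
    by rewrite setDE setICA setICr setI0.
  have AF : A `\` F `<=` U `\` F by move=> x [/AO].
  rewrite -lee_fin -[(`|_|)%:E]/(`|(fine (la (A `\` F)))%:E|)%E fineK ?lafin//.
  exact/ltW/small.
have [phi [phib phi01 phiF phiO]] := urysohn_Cb cF oO FO.
have H1 : `|pairing mu phi - fine (mu F)| <= 2 * e.
  apply: (pairing_between rmu cF oO FO) => // C mC CO.
  by apply/ltW/small1 => //; exact: subset_trans sub1.
have H2 : `|pairing nu phi - fine (nu F)| <= 2 * e.
  apply: (pairing_between rnu cF oO FO) => // C mC CO.
  by apply/ltW/small2 => //; exact: subset_trans sub2.
have H3 : `|fine (mu A) - fine (mu F)| <= e.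
  by apply: close => // C mC CO; apply: small1 => //; exact: subset_trans sub1.
have H4 : `|fine (nu A) - fine (nu F)| <= e.
  by apply: close => // C mC CO; apply: small2 => //; exact: subset_trans sub2.
move: H1 H2 H3 H4; rewrite mn// !ler_norml.
move=> /andP[? ?] /andP[? ?] /andP[? ?] /andP[? ?]; apply/andP; split; lra.
Qed.

Definition shift_invariant (L : (X -> R) -> R) : Prop :=
  forall f, Cb f -> L (f \o @Defs.shift R E) = L f.

Lemma Msigma_invariant mu : Msigma mu -> shift_invariant (pairing mu).
Proof. by case. Qed.

Lemma Msigma_rba mu : Msigma mu -> rba mu.
Proof. by move=> [[]]. Qed.

Lemma riesz_Msigma (L : (X -> R) -> R) (mL : mean L) (sL : sigma_smooth L) :
  shift_invariant L -> Msigma (riesz_charge mL sL).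
Proof.
move=> invL; split; last first.
  by move=> f fb; rewrite !riesz_pairing ?invL//; exact: Cb_shift.
split; first exact: riesz_rba.
  by rewrite riesz_pairing; [case: mL|exact: Cb_cst].
by move=> f fb f0; rewrite riesz_pairing//; case: mL => _ pos _; exact: pos.
Qed.

(** Point evaluation at a fixed point of the shift is represented by the Dirac
    measure at this point. *)
Lemma dirac_Msigma (a : E) : exists mu, Msigma mu /\
  forall f, Cb f -> pairing mu f = f (fun=> a).
Proof.
pose L (f : X -> R) := f (fun=> a).
have mL : mean L by split=> // f _ f0; exact: f0.
have sL : sigma_smooth L.
  move=> phi _ _ phi0 e e0; have /cvgrPdist_le/(_ _ e0)[n _ ne] := phi0 (fun=> a).
  by exists n; have := ne n (leqnn n); rewrite sub0r normrN; exact: le_trans (ler_norm _).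
exists (riesz_charge mL sL); split; first exact: riesz_Msigma.
by move=> f fb; rewrite riesz_pairing.
Qed.

End charges.

(** * Entropy and tightness *)

Section covering_functions.
Context {R : realType} {E : metricType R}.
Variable a : nat -> E.

(** A continuous stand-in for the indicator of the complement of the union of
    the balls of radius [1 / k] around the first [N] points. *)
Fixpoint uncovered (k : R) (N : nat) (b : E) : R :=
  if N is N'.+1 then Num.min (uncovered k N' b) (k * mdist b (a N')) else 1.

Implicit Types (k : R) (N : nat) (b c : E).

Lemma uncovered_ge0 k N b : 0 <= k -> 0 <= uncovered k N b.
Proof.
by move=> k0; elim: N => //= N ih; rewrite le_min ih/= mulr_ge0// mdist_ge0.
Qed.

Lemma uncovered_le1 k N b : uncovered k N b <= 1.
Proof. by elim: N => //= N ih; rewrite ge_min ih. Qed.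

Lemma uncovered_lipschitz k N b c : 0 <= k ->
  `|uncovered k N b - uncovered k N c| <= k * mdist b c.
Proof.
move=> k0; elim: N => [|N ih] /=; first by rewrite subrr normr0 mulr_ge0// mdist_ge0.
have : `|k * mdist b (a N) - k * mdist c (a N)| <= k * mdist b c.
  rewrite -mulrBr normrM (ger0_norm k0) ler_wpM2l//.
  have := metric_triangle b c (a N); have := metric_triangle c b (a N).
  by rewrite (metric_sym c b) ler_norml => ? ?; apply/andP; split; lra.
move: ih; rewrite !ler_norml => /andP[? ?] /andP[? ?].
by rewrite /Num.min; case: ltP => ?; case: ltP => ?; apply/andP; split; lra.
Qed.

Lemma uncovered_continuous k N : 0 <= k -> continuous (uncovered k N).
Proof.
by move=> k0; apply: lipschitz_continuous => b c; exact: uncovered_lipschitz.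
Qed.

Lemma uncovered_lt k N b r : r <= 1 -> uncovered k N b < r ->
  exists2 l, (l < N)%N & k * mdist b (a l) < r.
Proof.
move=> r1; elim: N => [|N ih] /=; first by rewrite ltNge r1.
rewrite gt_min => /orP[/ih[l lN lr]|Nr]; last by exists N.
by exists l => //; exact: ltnW.
Qed.

Lemma uncovered_le k N b l : (l < N)%N -> uncovered k N b <= k * mdist b (a l).
Proof.
elim: N => //= N ih; rewrite ltnS leq_eqVlt ge_min => /orP[/eqP->|/ih->//].
by rewrite lexx orbT.
Qed.

Lemma uncovered_cvg k b : 0 <= k -> dense (range a) ->
  uncovered k N b @[N --> \oo] --> 0.
Proof.
move=> k0 da; apply/cvgrPdist_le => e e0.
have k1 : 0 < k + 1 by lra.
have d0 : 0 < e / (k + 1) by rewrite divr_gt0.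
have [x [/interior_subset bx [l _ alx]]] : interior (ball b (e / (k + 1))) `&` range a !=set0.
  by apply: da; [exists b; exact: nbhsx_ballx|exact: open_interior].
move: bx; rewrite -alx ballEmdist/= ltr_pdivlMr// mulrC => bl; exists l.+1 => // N /= lN.
rewrite sub0r normrN ger0_norm ?uncovered_ge0//.
apply: (le_trans (uncovered_le k b lN)); apply: le_trans (ltW bl).
by rewrite ler_wpM2r ?mdist_ge0// lerDl.
Qed.

End covering_functions.

Lemma separable_range {R : realType} (E : completeMetricType R) :
  separable E -> exists a : nat -> E, dense (range a).
Proof.
move=> [D [/countable_injP[f finj] dD]].
(* [f] numbers the points of [D]; the other integers are sent to [point] *)
exists (fun n => xget point [set x | D x /\ f x = n]) => U U0 oU.
have [x [Ux Dx]] := dD U U0 oU.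
exists x; split=> //; exists (f x) => //; case: xgetP => [y _ [Dy fyx]|/(_ x)]; last first.
  by move=> [].
by apply: finj => //; apply/mem_set.
Qed.

Section entropy_bound.
Context {R : realType} {E : completeMetricType R} (p : probability (borel E) R).
Local Notation X := (seq_space E).
Implicit Types (u : E -> R).

Lemma probability_pairing_cst (nu : probability (borel X) R) c :
  pairing nu (fun=> c) = c.
Proof.
have bnu : bounded_additive nu 1.
  split; first exact: measure_semi_additive.
  by move=> A mA; rewrite gee0_abs// probability_le1.
have b1 : Bb (fun _ : X => 1) by exact/Cb_Bb/Cb_cst.
have p1 : pairing nu (fun=> 1) = 1.
  have := pairing_indic bnu measurableT.
  by rewrite indicT probability_setT.
by rewrite -[RHS]mulr1 -p1 -(pairingZ c bnu b1); congr pairing; apply/funext => x; rewrite mulr1.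
Qed.

(** For a potential of the first coordinate, testing the eigenvalue equation
    against the constant function [1] shows that the only possible eigenvalue is
    the integral of [expR u].  When there is none, [lambda] takes the default
    value [0], whose logarithm is [0]. *)
Lemma ln_lambda_le u B : 1 <= B -> \int[p]_a expR (u a) <= B ->
  ln (lambda p (fun x : X => u (x 0%N))) <= ln B.
Proof.
move=> B1 uB; rewrite /lambda; case: xgetP => [l _ [l0 [nu lnu]]|_]; last first.
  by rewrite ln0// ln_ge0.
have := lnu _ (Cb_cst 1).
rewrite (_ : ruelle _ _ _ = fun=> \int[p]_a expR (u a)); last first.
  by apply/funext => x; apply: eq_Rintegral => b _; rewrite mulr1.
rewrite !probability_pairing_cst mulr1 => ul.
by rewrite ler_ln ?posrE// -?ul//; exact: lt_le_trans B1.
Qed.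

(** By density of [a] the integrand decreases to [1] as [N] grows. *)
Lemma exp_uncovered_integral_le (a : nat -> E) k t : 0 <= k -> 0 <= t ->
  dense (range a) -> exists N, \int[p]_b expR (t * uncovered a k N b) <= 2.
Proof.
move=> k0 t0 da; pose f N b := (expR (t * uncovered a k N b))%:E.
have mu_ N : measurable_fun [set: borel E] (uncovered a k N : borel E -> R).
  apply: (measurability _ (RGenOpens.measurableE R)).
  move=> _ [_ [x [y ->] <-]]; rewrite setTI; apply: sub_sigma_algebra.
  by have /continuousP := @uncovered_continuous _ _ a k N k0; apply; exact: interval_open.
have mf N : measurable_fun [set: borel E] (f N).
  apply/measurable_EFinP; apply: measurableT_comp; first exact: measurable_expR.
  exact: measurable_funM.
have : (\int[p]_b f N b)%E @[N --> \oo] --> (\int[p]_b 1)%E.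
  apply: (@dominated_cvg _ _ _ p _ measurableT f (fun=> 1%E) (fun=> (expR t)%:E)) => //.
  - move=> b _; apply: cvg_EFin; first exact: nearW.
    have tu0 : (t * uncovered a k N b) @[N --> \oo] --> 0.
      by have := cvgM (cvg_cst t) (uncovered_cvg b k0 da); rewrite mulr0; apply.
    have := continuous_cvg _ (@continuous_expR R 0) tu0.
    by rewrite expR0; apply.
  - exact: finite_measure_integrable_cst.
  - move=> N b _; rewrite /f gee0_abs ?lee_fin ?expR_ge0// ler_expR.
    by rewrite ler_piMr// uncovered_le1.
have -> : (\int[p]_(b in setT) 1 = 1)%E.
  by rewrite integral_cst// mul1e; exact: probability_setT.
move=> /fine_cvg/cvgrPdist_le/(_ _ ltr01).
move=> [N _ /(_ _ (leqnn N))]/=; rewrite ler_norml => /andP[? _].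
by exists N; rewrite /Rintegral; lra.
Qed.

(** The distance of two sequences is at most [1], so it is dominated by its power
    [alpha]: a Lipschitz function is Hoelder. *)
Lemma first_coordinate_Hol u k t alpha : 0 <= k -> 0 <= t -> 0 < alpha < 1 ->
  (forall b, 0 <= u b <= 1) -> (forall b c, `|u b - u c| <= k * mdist b c) ->
  Hol alpha (fun x : X => t * u (x 0%N)).
Proof.
move=> k0 t0 /andP[al0 al1] u01 uk; split.
  apply/CbZ/(@CbI _ _ _ 1) => x.
    apply: (@continuous_comp X E R (fun x => x 0%N) u); last exact: lipschitz_continuous uk _.
    exact: coordinate_continuous.
  by have /andP[? ?] := u01 (x 0%N); rewrite ger0_norm.
apply: (@le_lt_trans _ _ (t * (2 * (k + 1)))%:E); last exact: ltry.
apply: ge_ereal_sup => _ [[x y] /= xy <-]; rewrite lee_fin.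
have d0 : 0 < mdist x y by rewrite mdist_gt0; apply/eqP.
rewrite ler_pdivrMr ?powR_gt0// -mulrBr normrM (ger0_norm t0) -mulrA ler_wpM2l//.
apply: (@le_trans _ _ (2 * (k + 1) * mdist x y)); last first.
  by rewrite ler_wpM2l ?ger1_powR ?d0 ?seq_dist_le1 ?(ltW al1)//; lra.
have := seq_dist_ge x y 0; rewrite expr1.
have := uk (x 0%N) (y 0%N); have /andP[? ?] := u01 (x 0%N); have /andP[? ?] := u01 (y 0%N).
have : `|u (x 0%N) - u (y 0%N)| <= 1 by rewrite ler_norml; apply/andP; split; lra.
have := mdist_ge0 (x 0%N) (y 0%N).
rewrite /Num.min; case: ltP => ? ? ? ? ?; nra.
Qed.

Lemma entropy_bound mu u k t B c alpha : 0 <= k -> 0 <= t -> 0 < alpha < 1 ->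
  (forall b, 0 <= u b <= 1) -> (forall b c, `|u b - u c| <= k * mdist b c) ->
  1 <= B -> \int[p]_b expR (t * u b) <= B ->
  ((- c)%:E <= entropy p alpha mu)%E ->
  pairing mu (fun x : X => t * u (x 0%N)) <= c + ln B.
Proof.
move=> k0 t0 al01 u01 uk B1 uB /le_trans cmu.
have : ((- c)%:E <= (- pairing mu (fun x : X => (t * u (x 0%N))) +
    ln (lambda p (fun x : X => (t * u (x 0%N)))))%:E)%E.
  apply: cmu; apply: ereal_inf_lbound.
  exists (fun x : X => t * u (x 0%N)) => //.
  exact: first_coordinate_Hol uk.
rewrite lee_fin; have := @ln_lambda_le (fun b => t * u b) B B1 uB; lra.
Qed.

Lemma entropy_le0 (mu : {additive_charge set (borel X) -> \bar R}) alpha :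
  0 < alpha < 1 -> rba mu -> (entropy p alpha mu <= 0)%E.
Proof.
move=> al01 /rba_bounded_additive[M bmu].
have b0 : Bb (fun _ : X => 0) by exact/Cb_Bb/Cb_cst.
have p0 : pairing mu (fun=> 0) = 0.
  by have := pairingZ 0 bmu b0; rewrite !mul0r.
have H0 : Hol alpha (fun _ : X => 0).
  have := @first_coordinate_Hol (fun=> 0) 0 0 alpha (lexx 0) (lexx 0) al01.
  under eq_fun do rewrite mul0r; apply => [b|b c]; first by rewrite lexx ler01.
  by rewrite subrr normr0 mul0r.
apply: (@le_trans _ _ (- pairing mu (fun=> 0) + ln (lambda p (fun _ : X => 0)))%:E).
  by apply: ereal_inf_lbound; exists (fun=> 0).
rewrite p0 oppr0 add0r lee_fin.
have I1 : \int[p]_(b in setT) expR 0 <= 1.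
  rewrite Rintegral_cst// expR0 mul1r (_ : fine _ = fine 1%E)//.
  by congr fine; exact: probability_setT.
by have := @ln_lambda_le (fun=> 0) 1 (lexx 1) I1; rewrite ln1.
Qed.

(** A lower bound on the entropy makes the laws of the first coordinate
    uniformly tight: for every [t], the logarithm of [lambda] at the potential
    [t * uncovered] is at most [ln 2] once enough points are taken into account,
    and [t] can be chosen large compared with [c]. *)
Lemma entropy_tight (a : nat -> E) k c e alpha : 0 <= k -> 0 <= c -> 0 < e ->
  0 < alpha < 1 -> dense (range a) ->
  exists N, forall mu : {additive_charge set (borel X) -> \bar R},
    Msigma mu -> ((- c)%:E <= entropy p alpha mu)%E ->
    pairing mu (fun x => uncovered a k N (x 0%N)) <= e.
Proof.
move=> k0 c0 e0 al01 da; have ln2 : 0 <= ln 2 :> R by rewrite ln_ge0// ler1n.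
pose t := (c + ln 2 + 1) / e.
have t0 : 0 < t by rewrite divr_gt0//; lra.
have [N uN] := exp_uncovered_integral_le k0 (ltW t0) da; exists N => mu Mmu cmu.
have u01 b : 0 <= uncovered a k N b <= 1 by rewrite uncovered_ge0//= uncovered_le1.
have ul b c' : `|uncovered a k N b - uncovered a k N c'| <= k * mdist b c'.
  exact: uncovered_lipschitz.
have := entropy_bound k0 (ltW t0) al01 u01 ul _ uN cmu; rewrite ler1n => /(_ isT).
have [M bmu] := rba_bounded_additive (Msigma_rba Mmu).
have ub : Cb (fun x : X => uncovered a k N (x 0%N)).
  have := (@first_coordinate_Hol _ k 1 alpha k0 ler01 al01 u01 ul).1.
  by under eq_fun do rewrite mul1r.
rewrite (pairingZ t bmu (Cb_Bb ub)) => tc.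
rewrite -(ler_pM2l t0); apply: (le_trans tc).
by rewrite /t divfK ?gt_eqF//; lra.
Qed.

End entropy_bound.

(** * Tight means are sigma-smooth *)

Lemma ultra_finite_cover (T : Type) (G : set_system T) (N : nat) (A : nat -> set T) :
  UltraFilter G -> G [set x | exists2 l, (l < N)%N & A l x] ->
  exists2 l, (l < N)%N & G (A l).
Proof.
move=> UG GA; apply: contrapT => nA.
have : G [set x | forall l : 'I_N, (~` A l) x].
  apply: filter_forall => l; have [GAl|//] := in_ultra_setVsetC (A l) UG.
  by exfalso; apply: nA; exists l.
move=> /(filterI GA)/filter_ex[x [[l lN Alx] /(_ (Ordinal lN))]].
exact.
Qed.

Lemma ultra_bounded_cvg (R : realType) (T : Type) (G : set_system T) (u : T -> R) K :
  UltraFilter G -> (forall x, `|u x| <= K) -> cvg (u x @[x --> G]).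
Proof.
move=> UG uK.
pose S := [set r | G [set x | r <= u x]].
have supS : has_sup S.
  split.
    exists (- K); rewrite /S/=; apply: filterS filterT => x _ /=.
    by have := uK x; rewrite ler_norml => /andP[].
  exists K => r /filter_ex[x /= ru]; apply: (le_trans ru).
  by have := uK x; rewrite ler_norml => /andP[].
apply/cvg_ex; exists (sup S); apply/cvgrPdist_le => e e0.
have [r Sr er] := sup_adherent e0 supS.
have G1 : G [set x | sup S - e < u x].
  by apply: filterS Sr => x /= ; exact: lt_le_trans.
have G2 : G (~` [set x | sup S + e <= u x]).
  have [Ge|//] := in_ultra_setVsetC [set x | sup S + e <= u x] UG.
  by have := ub_le_sup supS.2 Ge; rewrite leNgt ltrDl e0.
apply: filterS (filterI G1 G2) => x /= [? /negP]; rewrite -ltNge => ?.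
by rewrite ler_distl; apply/andP; split; lra.
Qed.

Section tightness.
Context {R : realType} {E : completeMetricType R}.
Local Notation X := (seq_space E).
Variables (a : nat -> E) (L : (X -> R) -> R).
Hypotheses (mL : mean L) (invL : shift_invariant L).

Definition tight_first_coordinate : Prop := forall k e, 0 <= k -> 0 < e ->
  exists N, L (fun x : X => uncovered a k N (x 0%N)) <= e.

Let Cb_uncovered k N j : 0 <= k -> Cb (fun x : X => uncovered a k N (x j)).
Proof.
move=> k0; apply: (@CbI _ _ _ 1) => x; last first.
  by rewrite ger0_norm ?uncovered_le1// uncovered_ge0.
apply: (@continuous_comp X E R (fun x => x j)); first exact: coordinate_continuous.
exact: uncovered_continuous.
Qed.

Let mean_uncovered k N j : 0 <= k ->
  L (fun x : X => uncovered a k N (x j)) = L (fun x : X => uncovered a k N (x 0%N)).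
Proof.
by move=> k0; elim: j => // j <-; rewrite -(invL (Cb_uncovered N j k0)).
Qed.

(** Points whose coordinates are all covered at all scales converge along an
    ultrafilter, because [E] is complete. *)
Lemma covered_cvg (G : set_system nat) (x : nat -> X) (N : nat -> nat) :
  UltraFilter G -> \oo `<=` G ->
  (forall m i j, (i < m)%N -> (j <= i)%N ->
    uncovered a i.+1%:R (N i) (x m j) < 2^-1) ->
  exists y : X, x @ G --> y.
Proof.
move=> UG ooG xN.
have cvg_coord j : exists b : E, (fun m => x m j) @ G --> b.
  apply/cvg_ex; apply: cauchy_cvg; apply: cauchy_exP => e e0.
  pose i := maxn j `|Num.ceil e^-1|%N.
  have ie : e^-1 <= i.+1%:R.
    rewrite (le_trans (ceil_ge _))// (@le_trans _ _ `|Num.ceil e^-1|%N%:R)//.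
      rewrite natr_absz ger0_norm//.
      by rewrite -(ler_int R) (le_trans _ (ceil_ge _))// invr_ge0 ltW.
    by rewrite ler_nat leqW// leq_maxr.
  have : G [set m | exists2 l, (l < N i)%N & ball (a l) e (x m j)].
    apply: ooG; exists i.+1 => // m /= im.
    have half1 : 2^-1 <= 1 :> R by rewrite invf_le1// ler1n.
    have [l lN lx] := uncovered_lt half1 (xN m i j im (leq_maxl _ _)).
    exists l => //; rewrite ballEmdist/= metric_sym.
    have i0 : 0 < i.+1%:R :> R by [].
    rewrite -(ltr_pM2l i0); apply: (lt_le_trans lx).
    apply: (@le_trans _ _ 1) => //.
    by rewrite -ler_pdivrMr// mul1r.
  pose B l := [set m | ball (a l) e (x m j)].
  by move=> /(ultra_finite_cover (A := B) UG)[l _ Gl]; exists (a l).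
have /choice[y xy] := cvg_coord.
by exists y; apply: coordinatewise_cvg.
Qed.

(** Suppose that the functions [phi m] decrease to [0].  Invariance carries the
    bound on the first coordinate over to every coordinate; summed with geometric
    weights, the bounds control a function [w m] that is small in mean and at
    least one half outside the sequences covered at the first [m] scales.  On the
    covered sequences some [phi m] is uniformly small: otherwise there would be
    covered points [x m] with [phi m (x m)] bounded below, and their limit along
    an ultrafilter would contradict the pointwise convergence. *)
Lemma tight_sigma_smooth : tight_first_coordinate -> sigma_smooth L.
Proof.
move=> tL phi phib phimono phi0 e e0.
have [K K0 phiK] := Cb_bounded (phib 0%N).
have phi_ge0 n x : 0 <= phi n x.
  by have /andP[h1 h2] := phimono n x; exact: le_trans h1 h2.
have phi_anti m n x : (n <= m)%N -> phi m x <= phi n x.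
  move=> /subnK <-; elim: (m - n)%N => // d ih; apply: le_trans ih.
  by rewrite addSn; have /andP[] := phimono (d + n)%N x.
(* makes [2 * K * eta] smaller than [e / 2] *)
pose eta := e / (4 * K + 1).
have eta0 : 0 < eta by rewrite divr_gt0//; lra.
(* row [i] below has [i.+1] terms and receives the mass [eta / 2 ^ i.+1] *)
have d0 i : 0 < eta * 2^-1 ^+ i.+1 / i.+1%:R by rewrite divr_gt0// mulr_gt0// exprn_gt0// invr_gt0.
have /choice[N NP] : forall i, exists N,
    L (fun x : X => uncovered a i.+1%:R N (x 0%N)) <= eta * 2^-1 ^+ i.+1 / i.+1%:R.
  by move=> i; exact: tL.
pose c i j (x : X) := uncovered a i.+1%:R (N i) (x j).
have cb i j : Cb (c i j) by exact: Cb_uncovered.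
have c0 i j x : 0 <= c i j x by exact: uncovered_ge0.
pose row i (x : X) := \sum_(j < i.+1) c i j x.
have rowb i : Cb (row i) by exact: (@Cb_sum _ _ i.+1 (fun j => c i j)).
have row0 i x : 0 <= row i x by exact: sumr_ge0.
pose w m (x : X) := \sum_(i < m) row i x.
have wb m : Cb (w m) by exact: (@Cb_sum _ _ m row).
have Lw m : L (w m) <= eta.
  rewrite (mean_sum mL m rowb).
  apply: (@le_trans _ _ (\sum_(i < m) (eta * 2^-1 ^+ i.+1))).
    apply: ler_sum => i _; rewrite (mean_sum mL i.+1 (cb i)).
    under eq_bigr do rewrite /c mean_uncovered//.
    by rewrite sumr_const card_ord -[_ *+ i.+1]mulr_natr -ler_pdivlMr.
  have -> : \sum_(i < m) (eta * 2^-1 ^+ i.+1) = eta * (1 - 2^-1 ^+ m).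
    elim: m => [|m ih]; first by rewrite big_ord0 expr0 subrr mulr0.
    by rewrite big_ord_recr/= ih exprS; lra.
  by rewrite ler_piMr ?ltW// gerBl exprn_ge0// invr_ge0.
have [m Hm] : exists m, forall x, phi m x <= e / 2 + 2 * K * w m x.
  apply: contrapT => /forallNP nH.
  have /choice[x xP] : forall m, exists x, e / 2 + 2 * K * w m x < phi m x.
    by move=> m; have /existsNP[x /negP] := nH m; rewrite -ltNge => ?; exists x.
  have [G [UG ooG]] := ultraFilterLemma (_ : ProperFilter \oo).
  have w_lt m : w m (x m) < 2^-1.
    rewrite ltNge; apply/negP => wm; have := xP m.
    have := phi_anti m 0%N (x m) (leq0n m); have := phiK (x m).
    rewrite ler_norml => /andP[_ ?] ? ?; nra.
  have [y xy] : exists y : X, x @ G --> y.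
    apply: (covered_cvg (N := N) UG ooG) => m i j im ji.
    apply: le_lt_trans (w_lt m).
    rewrite /w (bigD1 (Ordinal im))//= /row (bigD1 (Ordinal (ji : (j < i.+1)%N)))//=.
    by rewrite -addrA ler_wpDr// addr_ge0// sumr_ge0// => k _; exact: sumr_ge0.
  have phiy n : e / 2 <= phi n y.
    have cphi : phi n (x m) @[m --> G] --> phi n y.
      by apply: (@continuous_cvg _ _ _ G); [exact: (phib n).1|exact: xy].
    rewrite leNgt; apply/negP => phin.
    have d : 0 < e / 2 - phi n y by rewrite subr_gt0.
    have near1 : G [set m | phi n (x m) < e / 2].
      move/cvgrPdist_lt : cphi => /(_ _ d); apply: filterS => k.
      by rewrite ltr_distlC /= => /andP[_]; lra.
    have near2 : G [set m | (n <= m)%N] by apply: ooG; exists n.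
    have [k [/= h1 h2]] := filter_ex (filterI near1 near2).
    have := xP k; have := phi_anti k n (x k) h2.
    have : 0 <= 2 * K * w k (x k) by rewrite !mulr_ge0// sumr_ge0.
    by move: h1; lra.
  have /cvgrPdist_lt/(_ (e / 2))[|n _ /(_ _ (leqnn n))] := phi0 y.
    by rewrite divr_gt0.
  by rewrite /= sub0r normrN ger0_norm// ltNge phiy.
exists m; apply: (@le_trans _ _ (L (fun x => 2 * K * w m x + e / 2))).
  apply: (le_mean mL) => //; last by move=> x; rewrite addrC.
  by apply: Cb_lin => //; exact: Cb_cst.
case: (mL) => lin _ _; rewrite (lin (2 * K) _ _ (wb m) (Cb_cst _)) (mean_cst mL).
have : 2 * K * L (w m) <= 2 * K * eta by rewrite ler_wpM2l// mulr_ge0.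
have : (4 * K + 1) * eta = e by rewrite mulrC /eta divfK//; apply/eqP; lra.
by move: eta0; lra.
Qed.

End tightness.

(** * Maximizing charges *)

Section maximizers.
Context {R : realType} {E : completeMetricType R}.
Local Notation X := (seq_space E).
Local Notation charges := ({additive_charge set (borel X) -> \bar R}).
Implicit Types (mu nu : charges) (f g : X -> R).

(** The values of a maximizing sequence bound its entropies from below, which
    makes the sequence tight; its limit along an ultrafilter is represented by a
    charge, and each affine functional whose infimum is the entropy is continuous
    along the sequence. *)
Lemma equilibrium_state_exists (p : probability (borel E) R) alpha f :
  separable E -> 0 < alpha < 1 -> Cb f -> exists mu : charges, Msigma mu /\
    (entropy p alpha mu + (pairing mu f)%:E)%E =
      ereal_sup [set (entropy p alpha nu + (pairing nu f)%:E)%E | nu in @Msigma R E].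
Proof.
move=> sepE al01 fb; set V := [set _ | _ in _]; set S := ereal_sup V.
have [K K0 fK] := Cb_bounded fb.
have pairing_abs nu g K' : Msigma nu -> Cb g -> (forall x, `|g x| <= K') ->
    `|pairing nu g| <= K'.
  by move=> Mnu; apply: mean_abs; apply: M1a_mean; case: Mnu.
have inS nu : Msigma nu -> (entropy p alpha nu + (pairing nu f)%:E <= S)%E.
  by move=> Mnu; apply: ereal_sup_ubound; exists nu.
have SK : (S <= K%:E)%E.
  apply: ge_ereal_sup => _ [nu Mnu <-]; rewrite -[leRHS]add0e leeD//.
    by apply: entropy_le0 => //; exact: Msigma_rba.
  by rewrite lee_fin (le_trans (ler_norm _))// pairing_abs.
have [Sninfty|Sfin] := eqVneq S -oo%E.
  have [mu [Mmu _]] := dirac_Msigma (point : E).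
  exists mu; split => //; apply/eqP; rewrite eq_le inS//=.
  by rewrite -/V -/S Sninfty leNye.
have {}Sfin : S \is a fin_num by rewrite fin_numE Sfin/= -ltey (le_lt_trans SK)// ltry.
pose s := fine S.
have /choice[mu_ muP] : forall n, exists mu : charges, Msigma mu /\
    (S - (n.+1%:R^-1)%:E < entropy p alpha mu + (pairing mu f)%:E)%E.
  move=> n; have n0 : 0 < n.+1%:R^-1 :> R by rewrite invr_gt0.
  by have [_ [mu Mmu <-] ?] := ub_ereal_sup_adherent n0 Sfin; exists mu.
have [G [UG ooG]] := ultraFilterLemma (_ : ProperFilter \oo).
pose L g : R := lim (pairing (mu_ n) g @[n --> G]).
have cvgL g : Cb g -> pairing (mu_ n) g @[n --> G] --> L g.
  move=> gb; have [K' _ gK'] := Cb_bounded gb.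
  by apply: (ultra_bounded_cvg UG) => n; apply: pairing_abs gK' => //; exact: (muP n).1.
have limL (u : R^nat) g l : Cb g -> u n @[n --> G] --> l ->
    (forall n, pairing (mu_ n) g = u n) -> L g = l.
  by move=> gb ul /funext gu; apply/cvg_lim => //; rewrite gu.
have mn n : mean (pairing (mu_ n)) by apply: M1a_mean; case: (muP n).1.
have mL : mean L.
  split=> [c g h gb hb|g gb g0|].
  - apply: (limL (fun n => c * pairing (mu_ n) g + pairing (mu_ n) h)).
    + exact: Cb_lin.
    + by apply: cvgD; [apply: cvgMr; exact: cvgL|exact: cvgL].
    + by move=> n; case: (mn n) => lin _ _; exact: lin.
  - apply: limr_ge; first by apply/cvg_ex; exists (L g); exact: cvgL.
    by apply: nearW => n; case: (mn n) => _ pos _; exact: pos.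
  - apply: (limL (fun=> 1)); [exact: Cb_cst|exact: cvg_cst|].
    by move=> n; case: (mn n).
have invL : shift_invariant L.
  move=> g gb; apply: (limL (fun n => pairing (mu_ n) g)); first exact: Cb_shift.
    exact: cvgL.
  by move=> n; apply: Msigma_invariant => //; exact: (muP n).1.
have [a da] := separable_range sepE.
pose c : R := `|s| + 1 + K.
have c0 : 0 <= c by rewrite !addr_ge0.
have muc n : ((- c)%:E <= entropy p alpha (mu_ n))%E.
  have [Mn Sn] := muP n; have := pairing_abs _ _ _ Mn fb fK; rewrite ler_norml => /andP[_ pK].
  have n1 : n.+1%:R^-1 <= 1 :> R by rewrite invf_le1// ler1n.
  have s1 : - s <= `|s| by rewrite -normrN ler_norm.
  move: Sn; rewrite -[S]fineK// -/s; case: (entropy _ _ _) => [r| |]//=.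
    rewrite -EFinB -EFinD lte_fin lee_fin /c => sr.
    move: sr n1 pK s1; move: (pairing _ _) (n.+1%:R^-1) (`|s|) => q i t; lra.
  by rewrite leey.
have tL : tight_first_coordinate a L.
  move=> k e k0 e0; have [N NP] := entropy_tight p k0 c0 e0 al01 da; exists N.
  have [M bM] : exists M, bounded_additive (mu_ 0%N) M.
    exact/rba_bounded_additive/Msigma_rba/(muP 0%N).1.
  have ub : Cb (fun x : X => uncovered a k N (x 0%N)).
    apply: (@CbI _ _ _ 1) => x; last by rewrite ger0_norm ?uncovered_le1// uncovered_ge0.
    apply: (@continuous_comp X E R (fun x => x 0%N)); first exact: coordinate_continuous.
    exact: uncovered_continuous.
  apply: limr_le; first by apply/cvg_ex; exists (L (fun x => uncovered a k N (x 0%N))); exact: cvgL.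
  by apply: nearW => n; apply: NP => //; exact: (muP n).1.
have sL := tight_sigma_smooth mL invL tL.
exists (riesz_charge mL sL); split; first exact: riesz_Msigma.
apply/eqP; rewrite eq_le inS ?andTb; last exact: riesz_Msigma.
rewrite -/V -/S riesz_pairing// -leeBlDr//.
apply: le_ereal_inf_tmp => _ [g [gb gH] <-].
rewrite riesz_pairing// -[S]fineK// -/s -EFinB lee_fin.
have near_s : \forall n \near G, s - n.+1%:R^-1 <=
    - pairing (mu_ n) g + ln (lambda p g) + pairing (mu_ n) f.
  apply: nearW => n; have [_ /ltW] := muP n.
  have gn : (entropy p alpha (mu_ n) <= (- pairing (mu_ n) g + ln (lambda p g))%:E)%E.
    by apply: ereal_inf_lbound; exists g.
  by move=> /le_trans/(_ (leeD2r _ gn)); rewrite -[S]fineK// -/s -EFinB -EFinD lee_fin.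
have lim_l : (s - n.+1%:R^-1) @[n --> G] --> s.
  rewrite -[X in _ --> X]subr0; apply: cvgB; first exact: cvg_cst.
  apply: cvg_trans (@cvg_harmonic R); exact: cvg_app.
have lim_r : (- pairing (mu_ n) g + ln (lambda p g) + pairing (mu_ n) f) @[n --> G]
    --> - L g + ln (lambda p g) + L f.
  apply: cvgD; last exact: cvgL.
  by apply: cvgD; [apply: cvgN; exact: cvgL|exact: cvg_cst].
suff : s <= - L g + ln (lambda p g) + L f by lra.
rewrite -(cvg_lim _ lim_l)// -(cvg_lim _ lim_r)//.
by apply: ler_lim => //; apply/cvg_ex; eexists; [exact: lim_l|exact: lim_r].
Qed.

(** The potential is the negated distance to a fixed point of the shift.  A mean
    that vanishes on this distance is the evaluation at the fixed point, since a
    bounded continuous function differs from its value there by at most a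
    constant plus a multiple of the distance. *)
Lemma unique_maximizer_exists : exists f : X -> R, Cb f /\
  exists mu : charges, [/\ Msigma mu, (pairing mu f)%:E = max_mean f &
    forall nu : charges, Msigma nu -> (pairing nu f)%:E = max_mean f ->
    forall A : set (borel X), measurable A -> nu A = mu A].
Proof.
pose x0 : X := fun=> point.
pose f x := -1 * mdist x x0.
have db : Cb (fun x : X => mdist x x0).
  apply: (@CbI _ _ _ 1) => [|x]; last by rewrite ger0_norm ?mdist_ge0// seq_dist_le1.
  apply: (@lipschitz_continuous _ _ _ 1) => x y; rewrite mul1r ler_norml.
  have := metric_triangle x y x0; have := metric_triangle y x x0.
  by rewrite (metric_sym y x) => ? ?; apply/andP; split; lra.
have fb : Cb f by exact: CbZ.
exists f; split => //.
have [mu [Mmu muE]] := dirac_Msigma (point : E).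
have muf : pairing mu f = 0 by rewrite muE// /f mdistxx mulr0.
have maxE : max_mean f = 0%E.
  apply/eqP; rewrite eq_le; apply/andP; split; last first.
    by apply: ereal_sup_ubound; exists mu => //; rewrite muf.
  apply: ge_ereal_sup => _ [nu [Mnu _] <-]; have mnu := M1a_mean Mnu.
  rewrite lee_fin -(mean_cst mnu 0); apply: (le_mean mnu) => //; first exact: Cb_cst.
  by move=> x; rewrite /f; have := mdist_ge0 x x0; lra.
exists mu; split => //; first by rewrite muf maxE.
move=> nu Mnu; rewrite maxE => -[nuf]; have mnu := M1a_mean Mnu.1.
have nud : pairing nu (fun x => mdist x x0) = 0.
  by move: nuf; rewrite /f (meanZ mnu _ db); lra.
have nuE g : Cb g -> pairing nu g = g x0.
  move=> gb; have [K K0 gK] := Cb_bounded gb.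
  apply/eqP; rewrite -subr_eq0 -normr_le0.
  apply: (@le_scale0 _ 1) => // e e0; rewrite mul1r.
  have /cvgrPdist_le/(_ _ e0)/metricType_numDomainType.nbhs_mdistP[d /= d0 gd] := gb.1 x0.
  have bound x : `|g x0 - g x| <= 2 * K / d * mdist x x0 + e.
    have [xd|xd] := ltP (mdist x0 x) d.
      apply: (le_trans (gd _ xd)).
      by rewrite lerDr !mulr_ge0 ?mdist_ge0 ?invr_ge0// ltW.
    apply: (@le_trans _ _ (2 * K)).
      have := gK x0; have := gK x; rewrite !ler_norml => /andP[? ?] /andP[? ?].
      by apply/andP; split; lra.
    rewrite metric_sym in xd; apply: ler_wpDr; first exact: ltW.
    by rewrite -mulrA ler_peMr ?mulr_ge0// mulrC ler_pdivlMr// mul1r.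
  have hb : Cb (fun x : X => 2 * K / d * mdist x x0 + e).
    by apply: Cb_lin => //; exact: Cb_cst.
  have nuh : pairing nu (fun x : X => 2 * K / d * mdist x x0 + e) = e.
    by case: (mnu) => lin _ _; rewrite (lin _ _ _ db (Cb_cst e)) nud (mean_cst mnu) mulr0 add0r.
  have up : pairing nu g <= pairing nu (fun x => 1 * (2 * K / d * mdist x x0 + e) + g x0).
    apply: (le_mean mnu) => //; first by apply: Cb_lin => //; exact: Cb_cst.
    by move=> x; have := bound x; rewrite ler_norml => /andP[? ?]; lra.
  have lo : pairing nu (fun x => -1 * (2 * K / d * mdist x x0 + e) + g x0) <= pairing nu g.
    apply: (le_mean mnu) => //; first by apply: Cb_lin => //; exact: Cb_cst.
    by move=> x; have := bound x; rewrite ler_norml => /andP[? ?]; lra.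
  case: (mnu) => lin _ _; move: up lo.
  rewrite (lin _ _ _ hb (Cb_cst _)) (lin _ _ _ hb (Cb_cst _)) nuh (mean_cst mnu).
  by move=> ? ?; rewrite ler_norml; apply/andP; split; lra.
apply: rba_unique; [exact: Msigma_rba|exact: Msigma_rba|].
by move=> g gb; rewrite nuE// muE.
Qed.

End maximizers.

Theorem mainTheorem1 (R : realType) (E : completeMetricType R)
    (sepE : separable E) (p : probability (borel E) R)
    (alpha : R) (alpha01 : 0 < alpha < 1) :
  (forall f : seq_space E -> R, Cb f ->
    exists mu : {additive_charge set (borel (seq_space E)) -> \bar R},
      Msigma mu /\
      (entropy p alpha mu + (pairing mu f)%:E)%E =
        ereal_sup [set (entropy p alpha nu + (pairing nu f)%:E)%E
                  | nu in @Msigma R E])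
  /\
  (~ compact [set: E] ->
    exists f : seq_space E -> R, Cb f /\
    exists mu : {additive_charge set (borel (seq_space E)) -> \bar R},
      [/\ Msigma mu, (pairing mu f)%:E = max_mean f &
          forall nu : {additive_charge set (borel (seq_space E)) -> \bar R},
            Msigma nu -> (pairing nu f)%:E = max_mean f ->
            forall A : set (borel (seq_space E)), measurable A -> nu A = mu A]).
Proof.
split; first by move=> f fb; exact: equilibrium_state_exists.
by move=> _; exact: unique_maximizer_exists.
Qed.
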